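(* Let $f:\mathbb{R}^n\to\mathbb{R}$ be twice continuously differentiable and let $\phi$ be a reference function on $\mathbb{R}^n$ satisfying condition (S) given in the context. Let $L,\bar L>0$ and suppose that $f$ satisfies the second-order characterization of $(L,\bar L)$-anisotropic smoothness relative to $\phi$, i.e. $\lambda_{\max}(\nabla^2\phi^*(\bar L^{-1}\nabla f(x))\nabla^2 f(x))\le L\bar L$ for all $x\in\mathbb{R}^n$. Let $0<\gamma<\frac1L$ and consider the iterates $$x^{k+1}=x^k-\gamma\nabla\phi^*(\bar L^{-1}\nabla f(x^k)),\qquad k\in\mathbb{N},$$ where the initial iterate $x^0\in\mathbb{R}^n$ is chosen at random. Let $\mathcal{X}^\star=\{x^\star\mid\nabla f(x^\star)=0,\ \lambda_{\min}(\nabla^2 f(x^\star))<0\}$ be the set of strict saddle points of $f$. Then $$\mathbb{P}\Big(\lim_{k\to\infty}x^k\in\mathcal{X}^\star\Big)=0,$$ that is, the set of initial points $x^0\in\mathbb{R}^n$ for which $(x^k)_{k\in\mathbb{N}}$ converges to a point of $\mathcal{X}^\star$ has Lebesgue measure zero.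
   Context: Standing assumption: a reference function is a function $\phi:\mathbb{R}^n\to\overline{\mathbb{R}}$ that is proper, lower semicontinuous, strongly convex and even, with $\phi(0)=0$; $\phi^*$ is its convex conjugate. Condition (S): $\operatorname{int}\operatorname{dom}\phi\ne\emptyset$; $\phi\in\mathcal{C}^2(\operatorname{int}\operatorname{dom}\phi)$; and for any sequence $(x^k)$ converging to some boundary point of $\operatorname{int}\operatorname{dom}\phi$, $\|\nabla\phi(x^k)\|\to\infty$. (This ensures in particular $\phi^*\in\mathcal{C}^2(\mathbb{R}^n)$.) Normalization used by the paper: $\nabla^2\phi^*(0)=I$. *)

(* Defs.v *)
From HB Require Import structures.
From mathcomp Require Import all_boot all_order all_algebra.
From mathcomp Require Import all_classical all_reals all_analysis.

Set Implicit Arguments.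
Unset Strict Implicit.
Unset Printing Implicit Defensive.
Import Order.TTheory GRing.Theory Num.Theory.
Import numFieldNormedType.Exports.
Local Open Scope classical_set_scope.
Local Open Scope ring_scope.

(* Points of R^n are row vectors.  The library norm on 'rV[R]_n is the
   max-norm, which induces the usual topology; the metric notions below
   (strong convexity, blow-up of the gradient) use the Euclidean norm. *)
Section Euclidean.
Context {R : realType} {n : nat}.
Implicit Types x y : 'rV[R]_n.

Definition dotv x y : R := \sum_(i < n) x 0 i * y 0 i.

Definition enorm x : R := Num.sqrt (dotv x x).

End Euclidean.

Section Calculus.
Context {R : realType} {n : nat}.
Implicit Types (g : 'rV[R]_n -> R) (x : 'rV[R]_n) (U : set 'rV[R]_n).

Definition grad g x : 'rV[R]_n := \row_(i < n) 'D_(delta_mx 0 i) g x.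

(* Entry (i, j) is the i-th partial derivative of the j-th partial derivative
   of g, because the library Jacobian acts on row vectors from the right. *)
Definition hessian g x : 'M[R]_n := 'J (grad g) x.

(* Meant for U open. *)
Definition C2_on U g : Prop :=
  [/\ forall x, U x -> differentiable g x,
      forall x, U x -> differentiable (grad g) x &
      forall x, U x -> {for x, continuous (hessian g)}].

End Calculus.

(* Only real eigenvalues are considered.  This is the whole spectrum for the
   matrices used here: symmetric ones, and products of a positive semidefinite
   and a symmetric matrix. *)
Definition lambda_max {R : realType} {n : nat} (A : 'M[R]_n) : R :=
  sup [set a | eigenvalue A a].

Definition lambda_min {R : realType} {n : nat} (A : 'M[R]_n) : R :=
  inf [set a | eigenvalue A a].

Section ReferenceFunction.
Context {R : realType} {n : nat}.
Implicit Types phi : 'rV[R]_n -> \bar R.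

Definition edom phi : set 'rV[R]_n := [set x | (phi x < +oo)%E].

Definition proper_fun phi : Prop :=
  (exists x, (phi x < +oo)%E) /\ (forall x, (-oo < phi x)%E).

(* The products 0 * +oo arising at t = 0 and t = 1 are 0. *)
Definition strongly_convex phi : Prop :=
  exists2 mu : R, 0 < mu & forall (x y : 'rV[R]_n) (t : R), 0 <= t <= 1 ->
    (phi (t *: x + (1 - t) *: y)%R <=
       t%:E * phi x + (1 - t)%:E * phi y
       - (mu / 2 * t * (1 - t) * enorm (x - y)%R ^+ 2)%:E)%E.

Definition reference_function phi : Prop :=
  [/\ proper_fun phi, lower_semicontinuous phi, strongly_convex phi,
      (forall x : 'rV[R]_n, phi (- x) = phi x) & phi 0 = 0%E].

Definition conjugate phi (y : 'rV[R]_n) : \bar R :=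
  ereal_sup [set ((dotv x y)%:E - phi x)%E | x in [set: 'rV[R]_n]].

(* The conjugate of a reference function is finite everywhere; this is its
   real-valued version, to which grad and hessian apply. *)
Definition rconjugate phi : 'rV[R]_n -> R := fine \o conjugate phi.

Definition conditionS phi : Prop :=
  let U := interior (edom phi) in
  [/\ U !=set0,
      C2_on U (fine \o phi) &
      forall (u : nat -> 'rV[R]_n) (z : 'rV[R]_n),
        (forall k, U (u k)) -> (closure U `\` U) z -> u @ \oo --> z ->
        (fun k => enorm (grad (fine \o phi) (u k))) @ \oo --> +oo].

End ReferenceFunction.

Section Method.
Context {R : realType} {n : nat}.
Implicit Types (f : 'rV[R]_n -> R) (phi : 'rV[R]_n -> \bar R).

Definition anisotropic_smooth2 f phi (L Lbar : R) : Prop :=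
  forall x : 'rV[R]_n,
    lambda_max (hessian (rconjugate phi) (Lbar^-1 *: grad f x) *m hessian f x)
      <= L * Lbar.

Definition npgm_step f phi (Lbar gamma : R) (x : 'rV[R]_n) : 'rV[R]_n :=
  x - gamma *: grad (rconjugate phi) (Lbar^-1 *: grad f x).

Definition npgm f phi (Lbar gamma : R) (x0 : 'rV[R]_n) (k : nat) : 'rV[R]_n :=
  iter k (npgm_step f phi Lbar gamma) x0.

Definition strict_saddle f : set 'rV[R]_n :=
  [set x | grad f x = 0 /\ lambda_min (hessian f x) < 0].

End Method.

Section Lebesgue.
Context {R : realType} {n : nat}.
Implicit Types a b : 'rV[R]_n.

Definition box a b : set 'rV[R]_n :=
  [set x | forall i, x 0 i \in `]a 0 i, b 0 i]].

Definition box_volume a b : R := \prod_(i < n) Num.max 0 (b 0 i - a 0 i).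

(* Lebesgue outer measure: infimum of the total volume over all covers by
   countably many boxes.  The predicate D allows finite and empty families, so
   that the empty set is null also for n = 0. *)
Definition lebesgue_outer (A : set 'rV[R]_n) : \bar R :=
  ereal_inf [set s | exists (D : pred nat) (a b : nat -> 'rV[R]_n),
    A `<=` \bigcup_(k in [set k | D k]) box (a k) (b k) /\
    s = (\sum_(0 <= k <oo | D k) (box_volume (a k) (b k))%:E)%E].

(* A subset of R^n has Lebesgue measure zero (for the completed measure) iff
   its outer measure vanishes. *)
Definition lebesgue_null (A : set 'rV[R]_n) : Prop := lebesgue_outer A = 0%E.

End Lebesgue.

(* Main.v *)
Require Import Defs.
From HB Require Import structures.
From mathcomp Require Import all_boot all_order all_algebra.
From mathcomp Require Import all_classical all_reals all_analysis.
From mathcomp Require Import ring lra.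
Import Order.TTheory GRing.Theory Num.Theory.
Import numFieldNormedType.Exports.
Local Open Scope classical_set_scope.
Local Open Scope ring_scope.

(** Write T x = x - gamma *: grad phi^* (Lbar^-1 *: grad f x) for the step of
the method. Two facts make strict saddles repelling for almost every start.

First, T is strictly differentiable at every point, and its derivative
1 - (gamma / Lbar) H P, with H and P the Hessians of f and of phi^*, is
invertible: a kernel vector would make Lbar / gamma an eigenvalue of P H, but
the smoothness condition bounds these by L Lbar < Lbar / gamma. Hence T expands
distances locally up to a constant [strict_diff_expansive], and preimages of
null sets under T and its iterates are null [negligible_dim_preimage_iter].

Second, at a strict saddle xs the normalization makes the derivative
S = 1 - (gamma / Lbar) H, which is symmetric and has an eigenvalue s > 1. Take e
in ]1, s^2[ that is not an eigenvalue of S^2, put B = S^2 - e and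
q w = <w B, w>. Since S and B commute, q (w S) = e q w + |w B|^2, and B is
invertible, so the strict inequality survives the linearization error:
q (T a - T b) >= e q (a - b) for a, b near xs [cone_expanded]. If the orbits of
a and b both stay near xs, then q (a - b) <= 0, as otherwise it would grow
geometrically along bounded orbits. But q is positive at the eigenvector v for
s, so the points whose orbit stays near xs form a Lipschitz graph over a
hyperplane transverse to v, which is null [cone_free_negligible]. This graph
plays the part of the center-stable manifold.

An orbit converging to a strict saddle eventually stays in a ball with rational
data of the above kind, so the set of starting points is covered by countably
many preimages of null sets [saddle_basin_negligible].

The differentiability of grad phi^* rests on the Legendre correspondence. By
strong convexity phi - <., y> has a minimizer; by the blow-up of grad phi it
lies in the interior of the domain [tilted_min_interior], so it inverts
grad phi there; it depends on y in a Lipschitz way and equals grad phi^* y.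
The inverse of a strictly differentiable map with invertible derivative, once
known to be Lipschitz, is strictly differentiable [strict_diff_inverse]. *)

(** * Row vectors: max-norm and scalar product *)

Section RowVectors.
Set Implicit Arguments.
Unset Strict Implicit.
Context {R : realType}.

Lemma mx_coord_le_norm m n (A : 'M[R]_(m, n)) i j : `|A i j| <= `|A|.
Proof.
rewrite [leRHS]/Num.norm /= mx_normrE.
by apply/bigmax_geP; right; exists (i, j).
Qed.

Lemma rv_norm_le n (x : 'rV[R]_n) (c : R) :
  0 <= c -> (forall i, `|x 0 i| <= c) -> `|x| <= c.
Proof.
move=> c0 xc; rewrite [leLHS]/Num.norm /= mx_normrE.
apply/bigmax_leP; split=> // -[i j] _ /=.
by rewrite (ord1 i).
Qed.

Lemma mulmx_norm_le m n (x : 'rV[R]_m) (A : 'M[R]_(m, n)) :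
  `|x *m A| <= m%:R * `|A| * `|x|.
Proof.
apply: rv_norm_le => [|j]; first by rewrite !mulr_ge0.
rewrite mxE; apply: le_trans (ler_norm_sum _ _ _) _.
have -> : m%:R * `|A| * `|x| = \sum_(k < m) `|A| * `|x|.
  by rewrite sumr_const card_ord -[RHS]mulr_natl mulrA.
apply: ler_sum => k _; rewrite normrM mulrC.
by apply: ler_pM => //; apply: mx_coord_le_norm.
Qed.

Section Dot.
Context {n : nat}.
Implicit Types (x y z : 'rV[R]_n) (A : 'M[R]_n).

Lemma dotvC x y : dotv x y = dotv y x.
Proof. by apply: eq_bigr => i _; rewrite mulrC. Qed.

Lemma dotvDl x y z : dotv (x + y) z = dotv x z + dotv y z.
Proof. by rewrite -big_split; apply: eq_bigr => i _; rewrite mxE mulrDl. Qed.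

Lemma dotvZl a x z : dotv (a *: x) z = a * dotv x z.
Proof. by rewrite mulr_sumr; apply: eq_bigr => i _; rewrite mxE mulrA. Qed.

Lemma dotvNl x z : dotv (- x) z = - dotv x z.
Proof. by rewrite -scaleN1r dotvZl mulN1r. Qed.

Lemma dotvBl x y z : dotv (x - y) z = dotv x z - dotv y z.
Proof. by rewrite dotvDl dotvNl. Qed.

Lemma dotvDr x y z : dotv z (x + y) = dotv z x + dotv z y.
Proof. by rewrite dotvC dotvDl !(dotvC z). Qed.

Lemma dotvZr a x z : dotv z (a *: x) = a * dotv z x.
Proof. by rewrite dotvC dotvZl (dotvC z). Qed.

Lemma dotvNr x z : dotv z (- x) = - dotv z x.
Proof. by rewrite dotvC dotvNl (dotvC z). Qed.

Lemma dotvBr x y z : dotv z (x - y) = dotv z x - dotv z y.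
Proof. by rewrite dotvDr dotvNr. Qed.

Lemma dotv0l z : dotv 0 z = 0.
Proof. by rewrite -(scale0r 0) dotvZl mul0r. Qed.

Lemma dotv_mulmx x y A : dotv (x *m A) y = dotv x (y *m A^T).
Proof.
have E (u v : 'rV[R]_n) : dotv u v = (u *m v^T) 0 0.
  by rewrite mxE; apply: eq_bigr => i _; rewrite mxE.
by rewrite !E trmx_mul trmxK mulmxA.
Qed.

Lemma dotv_delta x i : dotv x (delta_mx 0 i) = x 0 i.
Proof.
rewrite /dotv (bigD1 i) //= big1 ?addr0; first by rewrite mxE !eqxx mulr1.
by move=> j /negbTE ji; rewrite mxE eqxx ji mulr0.
Qed.

Lemma dotv_norm_le x y : `|dotv x y| <= n%:R * `|x| * `|y|.
Proof.
apply: le_trans (ler_norm_sum _ _ _) _.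
have -> : n%:R * `|x| * `|y| = \sum_(k < n) `|x| * `|y|.
  by rewrite sumr_const card_ord -[RHS]mulr_natl mulrA.
apply: ler_sum => k _; rewrite normrM.
by apply: ler_pM => //; apply: mx_coord_le_norm.
Qed.

Lemma dotvv_ge x : `|x| ^+ 2 <= dotv x x.
Proof.
have dge0 : 0 <= dotv x x by apply: sumr_ge0 => i _; rewrite -expr2 sqr_ge0.
rewrite -(sqr_sqrtr dge0) lerXn2r ?nnegrE ?sqrtr_ge0//.
apply: rv_norm_le => [|i]; first exact: sqrtr_ge0.
rewrite -sqrtr_sqr ler_wsqrtr// expr2 [leRHS](bigD1 i)//= lerDl.
by apply: sumr_ge0 => j _; rewrite -expr2 sqr_ge0.
Qed.

Lemma dotvv_ge0 x : 0 <= dotv x x.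
Proof. exact: le_trans (dotvv_ge x). Qed.

Lemma enorm_sqr x : enorm x ^+ 2 = dotv x x.
Proof. by rewrite sqr_sqrtr // dotvv_ge0. Qed.

End Dot.

Lemma unitmx_norm_ge n (A : 'M[R]_n) : A \in unitmx ->
  exists2 c, 0 < c & forall x : 'rV[R]_n, c * `|x| <= `|x *m A|.
Proof.
move=> Au; pose K := n%:R * `|invmx A| + 1.
have K0 : 0 < K by rewrite ltr_wpDl // mulr_ge0.
exists K^-1; first by rewrite invr_gt0.
move=> x; rewrite ler_pdivrMl//.
rewrite -{1}(mulmxK Au x); apply: le_trans (mulmx_norm_le _ _) _.
by rewrite ler_wpM2r// lerDl.
Qed.

Lemma unitmx_ker n (A : 'M[R]_n) :
  (forall x : 'rV[R]_n, x *m A = 0 -> x = 0) -> A \in unitmx.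
Proof.
move=> kA; rewrite -row_free_unit -kermx_eq0; apply/eqP/row_matrixP => i.
by rewrite row0; apply: kA; apply/sub_kermxP; exact: row_sub.
Qed.

(** Fixes the norm-induced filter, as the neighbourhoods of a matrix also have
an entrywise description which unification may pick instead. *)
Lemma rv_nbhsP n (x : 'rV[R]_n) (P : set 'rV[R]_n) :
  nbhs x P <-> exists2 d : R, 0 < d & forall y, `|x - y| < d -> P y.
Proof. exact: (@nbhs_normP R 'rV[R]_n x P). Qed.

End RowVectors.

(** * Negligible sets *)

Section Negligible.
Set Implicit Arguments.
Unset Strict Implicit.
Context {R : realType}.

(** For balls in a space of dimension s this is Lebesgue nullity; in general it
is the vanishing of the s-dimensional Hausdorff measure. The dimension s is kept
separate from the space so that bounded sets of 'rV_m can be said to be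
negligible in dimension m.+1, as the base of a Lipschitz graph is. An arbitrary
countable index type makes both countable unions and finite grids direct. *)
Definition negligible_dim {V : normedModType R} (s : nat) (A : set V) :=
  forall e : R, 0 < e -> exists (I : countType) (c : I -> V) (r : I -> R),
    [/\ forall i, 0 <= r i,
        A `<=` \bigcup_i [set x | `|x - c i| <= r i] &
        forall t : seq I, uniq t -> \sum_(i <- t) r i ^+ s <= e].

Lemma negligible_dim_sub (V : normedModType R) s (A B : set V) :
  A `<=` B -> negligible_dim s B -> negligible_dim s A.
Proof.
move=> AB nB e e0; have [I [c [r [r0 Bc S]]]] := nB e e0.
by exists I, c, r; split=> //; apply: subset_trans Bc.
Qed.

Lemma sum_geometric_half (m : nat) : \sum_(k < m) (2 : R) ^- k.+1 <= 1.
Proof.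
suff -> : \sum_(k < m) (2 : R) ^- k.+1 = 1 - 2 ^- m.
  by rewrite gerBl invr_ge0 exprn_ge0.
elim: m => [|m IH]; first by rewrite big_ord0 expr0 invr1 subrr.
by rewrite big_ord_recr /= IH exprS; field; rewrite expf_neq0.
Qed.

(** The usual e / 2 ^ k argument, over the disjoint union of the index types. *)
Lemma negligible_dim_bigcup (V : normedModType R) s (A : nat -> set V) :
  (forall k, negligible_dim s (A k)) -> negligible_dim s (\bigcup_k A k).
Proof.
move=> nA e e0.
have pos k : 0 < e * 2 ^- k.+1 by rewrite mulr_gt0 // invr_gt0 exprn_gt0.
pose I k := projT1 (cid (nA k _ (pos k))).
pose c k : I k -> V := projT1 (cid (projT2 (cid (nA k _ (pos k))))).
pose Hc k := projT2 (cid (projT2 (cid (nA k _ (pos k))))).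
pose r k : I k -> R := projT1 (cid (Hc k)).
have Hr k : [/\ forall i, 0 <= r k i,
    A k `<=` \bigcup_i [set x | `|x - c k i| <= r k i] &
    forall t : seq (I k), uniq t -> \sum_(i <- t) r k i ^+ s <= e * 2 ^- k.+1].
  exact: projT2 (cid (Hc k)).
exists {k : nat & I k}, (fun u => c (tag u) (tagged u)),
  (fun u => r (tag u) (tagged u)); split.
- by move=> [k i] /=; have [] := Hr k.
- move=> x [k _ Akx]; have [_ /(_ _ Akx)[i _ xi] _] := Hr k.
  by exists (Tagged I i).
- move=> t ut.
  have blk (k : nat) :
      \sum_(u <- t | tag u == k) r (tag u) (tagged u) ^+ s <= e * 2 ^- k.+1.
    have [_ _ Sk] := Hr k.
    (* Partial inverse of the injection of I k in the disjoint union. *)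
    pose g (u : {k : nat & I k}) : option (I k) :=
      match eqVneq (tag u) k with
      | EqNotNeq E => Some (eq_rect _ I (tagged u) _ E)
      | _ => None
      end.
    have gP (u : {k : nat & I k}) : tag u = k -> exists2 i, g u = Some i & u = Tagged I i.
      case: u => j i /= E; subst j; rewrite /g /=.
      case: eqVneq => [E|/negP]; last by rewrite eqxx.
      by exists i => //; rewrite (eq_irrelevance E erefl).
    have gN (u : {k : nat & I k}) : tag u != k -> g u = None.
      by rewrite /g; case: eqVneq.
    have gK : ocancel g (Tagged I).
      move=> u; have [/gP[i -> ->]//|/gN ->] // := eqVneq (tag u) k.
    have -> : \sum_(u <- t | tag u == k) r (tag u) (tagged u) ^+ s =
              \sum_(i <- pmap g t) r k i ^+ s.
      elim: t {ut} => [|u t IH]; first by rewrite !big_nil.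
      rewrite big_cons /=; have [/gP[i -> uE]|/gN ->] := eqVneq (tag u) k; last exact: IH.
      by rewrite /= big_cons IH uE.
    by apply: Sk; apply: pmap_uniq gK _ ut.
  pose m := (\max_(u <- t) tag u).+1.
  have -> : \sum_(u <- t) r (tag u) (tagged u) ^+ s =
      \sum_(k < m) \sum_(u <- t | tag u == k) r (tag u) (tagged u) ^+ s.
    rewrite [RHS](exchange_big_dep predT) //=; apply: eq_big_seq => u ut'.
    have um : (tag u < m)%N by rewrite ltnS (leq_bigmax_seq (F := fun u => tag u)).
    by rewrite (big_pred1 (Ordinal um)) // => k; rewrite /= eq_sym -val_eqE.
  apply: (@le_trans _ _ (\sum_(k < m) e * 2 ^- k.+1)); last first.
    rewrite -mulr_sumr -[leRHS]mulr1 ler_pM2l//; exact: sum_geometric_half.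
  by apply: ler_sum => k _; exact: blk.
Qed.

(** Every ball containing some p x pulls back into a ball around one chosen point
of B, of radius at most 2 K times larger. This is the Lipschitz image of a null
set, phrased for the map p whose inverse on p @` B is K-Lipschitz. *)
Lemma negligible_dim_expansive (V W : normedModType R) s (B : set V) (p : V -> W)
    (K : R) : 0 < K ->
  (forall x y, B x -> B y -> `|x - y| <= K * `|p x - p y|) ->
  negligible_dim s (p @` B) -> negligible_dim s B.
Proof.
move=> K0 Bp nA e e0.
have K20 : 0 < (2 * K) ^+ s by rewrite exprn_gt0 // mulr_gt0.
have [|I [c [r [r0 Ac S]]]] := nA (e / (2 * K) ^+ s); first by rewrite divr_gt0.
pose P i x := B x /\ `|p x - c i| <= r i.
exists I, (fun i => get (P i)), (fun i => 2 * K * r i); split.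
- by move=> i; rewrite mulr_ge0 // mulr_ge0 // ltW.
- move=> x Bx; have [|i _ xi] := Ac (p x); first by exists x.
  exists i => //=; have [By yi] : P i (get (P i)) by apply: getPex; exists x.
  apply: le_trans (Bp _ _ Bx By) _; rewrite [2 * K]mulrC -mulrA ler_pM2l//.
  rewrite mulr_natl mulr2n -(subrK (c i) (p x)) -addrA.
  by apply: le_trans (ler_normD _ _) _; rewrite lerD// distrC.
- move=> t ut; have -> : \sum_(i <- t) (2 * K * r i) ^+ s =
      (2 * K) ^+ s * \sum_(i <- t) r i ^+ s.
    by rewrite mulr_sumr; apply: eq_bigr => i _; rewrite exprMn.
  by rewrite mulrC -ler_pdivlMr//; exact: S.
Qed.

(** A grid of mesh 2 M / N on a cube of side 2 M has (N + 1) ^ m nodes, and the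
m.+1-th power of the mesh makes the total O(1 / N). *)
Lemma negligible_dim_bounded m (A : set 'rV[R]_m) (M : R) : 0 < M ->
  (forall x, A x -> `|x| <= M) -> negligible_dim m.+1 A.
Proof.
move=> M0 AM e e0.
pose C := 2 ^+ m * (2 * M) ^+ m.+1.
have C0 : 0 < C by rewrite mulr_gt0 // exprn_gt0// mulr_gt0.
pose N := (Num.truncn (C / e)).+1.
have N0 : (0 : R) < N%:R by rewrite ltr0n.
have NC : C / e < N%:R by rewrite truncnS_gt.
pose h : R := 2 * M / N%:R.
have h0 : 0 < h by rewrite divr_gt0 // mulr_gt0.
exists {ffun 'I_m -> 'I_N.+1},
  (fun f : {ffun 'I_m -> 'I_N.+1} => \row_j (h * (f j)%:R - M)), (fun=> h).
split=> [_| |t ut]; first exact: ltW.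
- move=> x Ax.
  have yb (j : 'I_m) : 0 <= (x 0 j + M) / h /\ (x 0 j + M) / h <= N%:R.
    have := le_trans (mx_coord_le_norm x 0 j) (AM _ Ax); rewrite ler_norml => /andP[? ?].
    split; first by rewrite divr_ge0// ?(ltW h0)//; lra.
    by rewrite ler_pdivrMr // /h mulrC divfK ?gt_eqF//; lra.
  have kP (j : 'I_m) : (Num.truncn ((x ord0 j + M) / h)%R < N.+1)%N.
    have [y0 y1] := yb j; rewrite ltnS -(ler_nat R).
    by apply: le_trans y1; rewrite truncn_le.
  exists [ffun j => Ordinal (kP j)] => //=.
  apply: rv_norm_le => [|j]; first exact: ltW.
  rewrite !mxE ffunE /=; have [y0 _] := yb j.
  have /andP[] := truncn_itv y0; set k := (Num.truncn _).
  rewrite ler_pdivlMr // ltr_pdivrMr // -natr1 => k1 k2.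
  by rewrite ler_norml; apply/andP; split; lra.
- rewrite big_const_seq count_predT iter_addr_0.
  apply: (@le_trans _ _ (h ^+ m.+1 *+ (N.+1 ^ m))).
    rewrite -[leLHS]mulr_natr -[leRHS]mulr_natr ler_wpM2l ?exprn_ge0 ?(ltW h0)// ler_nat.
    rewrite -(card_uniqP ut) -[X in (_ <= X ^ _)%N]card_ord.
    rewrite -[X in (_ <= _ ^ X)%N]card_ord -card_ffun.
    exact: max_card.
  apply: (@le_trans _ _ (C / N%:R)); last first.
    by rewrite ler_pdivrMr // mulrC -ler_pdivrMr // ltW.
  rewrite -mulr_natr natrX /h exprMn exprVn.
  have -> : C / N%:R = (2 * M) ^+ m.+1 / N%:R ^+ m.+1 * (2 * N%:R) ^+ m.
    rewrite /C [_ ^+ m.+1 in RHS]exprS [N%:R ^+ m.+1]exprS.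
    rewrite [(2 * N%:R) ^+ m]exprMn (exprS (2 * M)).
    by field; rewrite expf_neq0 ?gt_eqF.
  rewrite ler_wpM2l ?mulr_ge0 ?invr_ge0 ?exprn_ge0 ?mulr_ge0 ?(ltW M0)//.
  rewrite lerXn2r ?nnegrE ?mulr_ge0// -natrM ler_nat.
  by rewrite mul2n -addnn -addn1 leq_add2l.
Qed.

Lemma box_volume_ge0 n (a b : 'rV[R]_n) : 0 <= box_volume a b.
Proof. by apply: prodr_ge0 => i _; rewrite le_max lexx. Qed.

Lemma lebesgue_outer_ge0 n (A : set 'rV[R]_n) : (0 <= lebesgue_outer A)%E.
Proof.
apply: le_ereal_inf_tmp => _ [D [a [b [_ ->]]]]; apply: nneseries_ge0 => k _ _.
by rewrite lee_fin box_volume_ge0.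
Qed.

(** A closed ball of radius r lies in a half-open box of side 2 (r + eta) for any
eta > 0. The eta_k <= 1 are chosen summable, and then the bound
(r + eta)^s <= 2^s (r^s + eta), valid for s > 0, keeps the total volume small. *)
Lemma negligible_lebesgue_null n (A : set 'rV[R]_n.+1) :
  negligible_dim n.+1 A -> lebesgue_null A.
Proof.
move=> nA; apply/eqP; rewrite eq_le lebesgue_outer_ge0 andbT.
apply/lee_addgt0Pr => e e0; rewrite add0e.
pose s := n.+1; pose d := e / (4 ^+ s * 2).
have d0 : 0 < d by rewrite divr_gt0 // mulr_gt0 // exprn_gt0.
have [I [c [r [r0 Ac S]]]] := nA d d0.
pose eta k : R := Num.min 1 (d * 2 ^- k.+1).
have eta0 k : 0 < eta k by rewrite lt_min ltr01 mulr_gt0 // invr_gt0 exprn_gt0.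
pose rho k (i : I) := r i + eta k.
pose D : pred nat := fun k => @pickle_inv I k != None.
pose a k : 'rV[R]_s := oapp (fun i => c i - const_mx (rho k i)) 0 (@pickle_inv I k).
pose b k : 'rV[R]_s := oapp (fun i => c i + const_mx (rho k i)) 0 (@pickle_inv I k).
apply: (@le_trans _ _ (\sum_(0 <= k <oo | D k) (box_volume (a k) (b k))%:E)%E).
  apply: ereal_inf_lbound; exists D, a, b; split=> // x /Ac[i _ /= xi].
  exists (pickle i); first by rewrite /= /D pickleK_inv.
  move=> j; rewrite /a /b pickleK_inv /= !mxE in_itv /=.
  have := le_trans (mx_coord_le_norm (x - c i) 0 j) xi.
  rewrite !mxE ler_norml => /andP[x1 x2].
  have := eta0 (pickle i); have := r0 i; rewrite /rho => ? ?.
  by apply/andP; split; lra.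
apply: lime_le.
  by apply: is_cvg_nneseries => k _ _; rewrite lee_fin box_volume_ge0.
apply: nearW => m; rewrite /= sumEFin lee_fin.
have vol k : D k -> exists i, @pickle_inv I k = Some i /\
    box_volume (a k) (b k) <= 4 ^+ s * (r i ^+ s + eta k).
  rewrite /D /a /b; case: (@pickle_inv I k) => [i _|//]; exists i; split=> //=.
  have rho0 : 0 <= rho k i by rewrite addr_ge0// ltW.
  rewrite /box_volume (eq_bigr (fun=> 2 * rho k i)); last first.
    move=> j _; rewrite !mxE max_r; first by ring.
    by rewrite -[leLHS](subrr (c i 0 j)) lerB// (le_trans (y := c i 0 j))// ?gerBl ?lerDl.
  rewrite prodr_const card_ord exprMn -[4]/(2 * 2)%:R natrM exprMn -mulrA.
  rewrite ler_pM2l ?exprn_gt0//.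
  apply: (@le_trans _ _ ((2 * Num.max (r i) (eta k)) ^+ s)).
    rewrite lerXn2r ?nnegrE ?mulr_ge0// ?le_max ?r0//.
    by rewrite /rho mulr_natl mulr2n lerD// le_max lexx ?orbT.
  rewrite exprMn ler_pM2l ?exprn_gt0//.
  have eta1 : eta k ^+ s <= eta k.
    by rewrite exprS ler_piMr ?(ltW (eta0 k))// exprn_ile1 ?(ltW (eta0 k))// ge_min lexx.
  case: (leP (r i) (eta k)) => _.
    by apply: le_trans eta1 _; rewrite lerDr exprn_ge0.
  by rewrite lerDl ltW.
pose t := pmap (@pickle_inv I) (iota 0 m).
have ut : uniq t by apply: pmap_uniq (@pickle_invK I) _ (iota_uniq _ _).
apply: (@le_trans _ _ (4 ^+ s * (\sum_(i <- t) r i ^+ s + \sum_(0 <= k < m) eta k))).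
  have -> : \sum_(i <- t) r i ^+ s =
      \sum_(0 <= k < m | D k) oapp (fun i => r i ^+ s) 0 (@pickle_inv I k).
    rewrite /t /index_iota subn0 /D.
    elim: (iota 0 m) => [|k l IH] /=; first by rewrite !big_nil.
    by rewrite [RHS]big_cons; case: (@pickle_inv I k) => [i|] /=; rewrite ?big_cons IH.
  rewrite mulrDr.
  apply: (@le_trans _ _ (4 ^+ s * (\sum_(0 <= k < m | D k)
      oapp (fun i => r i ^+ s) 0 (@pickle_inv I k)) +
    4 ^+ s * (\sum_(0 <= k < m | D k) eta k))).
    rewrite -mulrDr -big_split mulr_sumr; apply: ler_sum => k /vol[i [-> ]].
    by [].
  rewrite lerD2l ler_pM2l ?exprn_gt0// [leRHS](bigID D)/= lerDl.
  by apply: sumr_ge0 => k _; rewrite ltW.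
have -> : e = 4 ^+ s * (d + d) by rewrite /d; field; rewrite expf_neq0.
rewrite ler_pM2l ?exprn_gt0// lerD ?S// big_mkord.
apply: (@le_trans _ _ (\sum_(k < m) d * 2 ^- k.+1)).
  by apply: ler_sum => k _; rewrite ge_min lexx orbT.
rewrite -mulr_sumr -[leRHS]mulr1 ler_pM2l//; exact: sum_geometric_half.
Qed.

End Negligible.

(** * Strict differentiability *)

Section StrictDifferentiability.
Set Implicit Arguments.
Unset Strict Implicit.
Context {R : realType}.

(** A C1 map is strictly differentiable at each point. The notion concerns a single
point, so it passes at once to compositions and Lipschitz inverses, and it
compares the images of two nearby points, as the cone argument requires. *)
Definition strict_diff {m n} (F : 'rV[R]_m -> 'rV[R]_n)
    (x : 'rV[R]_m) (A : 'M[R]_(m, n)) :=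
  forall e : R, 0 < e -> exists2 d : R, 0 < d &
    forall a b, `|a - x| < d -> `|b - x| < d ->
      `|F a - F b - (a - b) *m A| <= e * `|a - b|.

Lemma is_derive_line (V W : normedModType R) (F : V -> W) (b u : V) (t : R) :
  differentiable F (b + t *: u) ->
  is_derive t 1 (fun s : R => F (b + s *: u)) ('d F (b + t *: u) u).
Proof.
move=> dF; have dl : is_diff t (fun s : R => b + s *: u) (0 + ( *:%R^~ u)).
  exact: is_diffD.
have dFl : differentiable (F \o (fun s : R => b + s *: u)) t.
  by apply: differentiable_comp => //; exact: dF.
apply: DeriveDef; first exact: diff_derivable.
by rewrite deriveE // diff_comp //= diff_val /= add0r scale1r.
Qed.

Lemma is_derive_line_coord m n (F : 'rV[R]_m -> 'rV[R]_n) b u (t : R) j :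
  differentiable F (b + t *: u) ->
  is_derive t 1 (fun s : R => F (b + s *: u) 0 j) ((u *m 'J F (b + t *: u)) 0 j).
Proof.
move=> /[dup] dF /is_derive_line[dl dv].
have dl' := (derivable_mxP _ _ _).1 dl.
apply: DeriveDef; first exact: dl'.
by rewrite /jacobian mul_rV_lin1 -dv derive_mx ?mxE.
Qed.

Lemma diff_gradE n (g : 'rV[R]_n -> R) x u : differentiable g x ->
  'd g x u = dotv (grad g x) u.
Proof.
move=> dg; rewrite {1}(row_sum_delta u) linear_sum; apply: eq_bigr => i _.
by rewrite linearZ /= mxE -deriveE // mulrC.
Qed.

Lemma is_derive_line_grad n (g : 'rV[R]_n -> R) b u (t : R) :
  differentiable g (b + t *: u) ->
  is_derive t 1 (fun s : R => g (b + s *: u)) (dotv (grad g (b + t *: u)) u).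
Proof. by move=> /[dup] dg /is_derive_line; rewrite diff_gradE. Qed.

Lemma MVT_from0 (g dg : R -> R) (t : R) : 0 < t ->
  (forall s, 0 <= s <= t -> is_derive s 1 g (dg s)) ->
  exists2 s, 0 <= s <= t & g t - g 0 = dg s * t.
Proof.
move=> t0 dgP; have [|||s] := @MVT R g dg 0 t.
- exact: t0.
- by move=> s; rewrite in_itv /= => /andP[/ltW ? /ltW ?]; apply/dgP/andP.
- apply: derivable_within_continuous => s; rewrite in_itv /= => /dgP.
  by case.
- rewrite in_itv /= subr0 => /andP[s0 s1] ->.
  by exists s; rewrite // !ltW.
Qed.

Lemma segment_in_ball m (x a b : 'rV[R]_m) (d t : R) :
  `|a - x| < d -> `|b - x| < d -> 0 <= t <= 1 ->
  `|b + t *: (a - b) - x| < d.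
Proof.
move=> ad bd /andP[t0 t1].
have -> : b + t *: (a - b) - x = t *: (a - x) + (1 - t) *: (b - x).
  by apply/rowP => i; rewrite !mxE; ring.
apply: le_lt_trans (ler_normD _ _) _; rewrite !normrZ !ger0_norm ?subr_ge0//.
have [ab|ab] := leP `|a - x| `|b - x|.
  apply: le_lt_trans bd; have := ler_wpM2l t0 ab; lra.
apply: le_lt_trans ad; have u0 : 0 <= 1 - t by lra.
have := ler_wpM2l u0 (ltW ab); lra.
Qed.

(** The mean value theorem is applied to each coordinate separately; the max-norm
absorbs the fact that the intermediate points differ. *)
Lemma C1_strict_diff m n (F : 'rV[R]_m -> 'rV[R]_n) x :
  (\forall y \near x, differentiable F y) ->
  {for x, continuous (fun y => 'J F y)} -> strict_diff F x ('J F x).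
Proof.
move=> /nbhs_normP[r /= r0 dF] cJ e e0.
pose e1 := e / (m%:R + 1).
have m0 : (0 : R) < m%:R + 1 by rewrite ltr_wpDl.
have e10 : 0 < e1 by rewrite divr_gt0.
have /cvgrPdist_le/(_ _ e10)/nbhs_normP[s /= s0 Js] := cJ.
exists (Num.min r s); first by rewrite lt_min r0.
move=> a b ad bd; apply: rv_norm_le => [|j]; first by rewrite mulr_ge0// ltW.
have seg t : 0 <= t <= 1 -> `|b + t *: (a - b) - x| < Num.min r s.
  exact: segment_in_ball.
have [t t01|t t01] := @MVT_from0 (fun t => F (b + t *: (a - b)) 0 j)
    (fun t => ((a - b) *m 'J F (b + t *: (a - b))) 0 j) _ ltr01.
  apply: is_derive_line_coord; apply: dF; rewrite /= distrC.
  by have := seg _ t01; rewrite lt_min => /andP[].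
rewrite scale1r scale0r addr0 (addrC b) subrK mulr1 => Ft.
set y := b + t *: (a - b) in Ft.
have -> : (F a - F b - (a - b) *m 'J F x) 0 j =
    ((a - b) *m ('J F y - 'J F x)) 0 j.
  by rewrite mulmxBr [LHS]mxE [RHS]mxE [X in X + _ = _]mxE [X in _ + X + _ = _]mxE Ft.
apply: le_trans (mx_coord_le_norm _ 0 j) _.
apply: le_trans (mulmx_norm_le _ _) _; rewrite ler_wpM2r//.
have Jy : `|'J F y - 'J F x| <= e1.
  rewrite distrC; apply: Js; rewrite /= distrC.
  by have := seg _ t01; rewrite lt_min => /andP[].
apply: le_trans (ler_wpM2l (ler0n _ _) Jy) _.
by rewrite /e1 mulrA ler_pdivrMr// mulrC ler_pM2l// lerDl.
Qed.

Lemma strict_diff_bounded m n (F : 'rV[R]_m -> 'rV[R]_n) x A :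
  strict_diff F x A -> exists2 d : R, 0 < d & exists2 K : R, 0 < K &
    forall a b, `|a - x| < d -> `|b - x| < d -> `|F a - F b| <= K * `|a - b|.
Proof.
move=> /(_ 1 ltr01)[d d0 Fd]; exists d => //.
exists (1 + m%:R * `|A|) => [|a b ad bd]; first by rewrite ltr_wpDr// mulr_ge0.
rewrite -(subrK ((a - b) *m A) (F a - F b)) mulrDl.
by apply: le_trans (ler_normD _ _) _; rewrite lerD ?Fd// mulmx_norm_le.
Qed.

Lemma strict_diff_comp l m n (F : 'rV[R]_l -> 'rV[R]_m) (G : 'rV[R]_m -> 'rV[R]_n)
    x A B :
  strict_diff F x A -> strict_diff G (F x) B -> strict_diff (G \o F) x (A *m B).
Proof.
move=> FA GB e e0; have [d1 d10 [K K0 FK]] := strict_diff_bounded FA.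
have e20 : 0 < e / 2 by rewrite divr_gt0.
have [d2 d20 Gd] := GB (e / 2 / K) (divr_gt0 e20 K0).
pose C := m%:R * `|B| + 1.
have C0 : 0 < C by rewrite ltr_wpDl// mulr_ge0.
have [d3 d30 Fd] := FA (e / 2 / C) (divr_gt0 e20 C0).
exists (Num.min (Num.min d1 d3) (d2 / K)); first by rewrite !lt_min d10 d30 divr_gt0.
move=> a b; rewrite !lt_min => /andP[/andP[a1 a3] a2] /andP[/andP[b1 b3] b2].
have Fx y : `|y - x| < d1 -> `|y - x| < d2 / K -> `|F y - F x| < d2.
  move=> y1 y2; apply: le_lt_trans (FK _ _ y1 _) _; first by rewrite subrr normr0.
  by rewrite mulrC -ltr_pdivlMr.
have -> : (G \o F) a - (G \o F) b - (a - b) *m (A *m B) =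
    (G (F a) - G (F b) - (F a - F b) *m B) + (F a - F b - (a - b) *m A) *m B.
  by rewrite [(_ - _ *m A) *m B]mulmxBl mulmxA addrA subrK.
apply: le_trans (ler_normD _ _) _; rewrite [e]splitr mulrDl lerD//.
  apply: le_trans (Gd _ _ (Fx _ a1 a2) (Fx _ b1 b2)) _.
  by rewrite -mulrA ler_pM2l// ler_pdivrMl// FK.
apply: le_trans (mulmx_norm_le _ _) _.
apply: (@le_trans _ _ (C * (e / 2 / C * `|a - b|))).
  apply: ler_pM; rewrite ?mulr_ge0// ?lerDl//; exact: Fd.
by rewrite mulrA [C * _]mulrC divfK ?gt_eqF.
Qed.

Lemma strict_diff_id n (x : 'rV[R]_n) : strict_diff id x 1%:M.
Proof.
move=> e e0; exists 1 => // a b _ _.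
by rewrite mulmx1 subrr normr0 mulr_ge0// ltW.
Qed.

Lemma strict_diffZ m n (F : 'rV[R]_m -> 'rV[R]_n) x A (k : R) :
  strict_diff F x A -> strict_diff (fun y => k *: F y) x (k *: A).
Proof.
move=> FA e e0; have k0 : 0 < `|k| + 1 by rewrite ltr_wpDl.
have [d d0 Fd] := FA (e / (`|k| + 1)) (divr_gt0 e0 k0).
exists d => // a b ad bd; rewrite -scalemxAr -!scalerBr normrZ.
apply: (@le_trans _ _ ((`|k| + 1) * (e / (`|k| + 1) * `|a - b|))).
  by apply: ler_pM; rewrite ?lerDl//; exact: Fd.
by rewrite mulrA [_ * (e / _)]mulrC divfK ?gt_eqF.
Qed.

Lemma strict_diffB m n (F G : 'rV[R]_m -> 'rV[R]_n) x A B :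
  strict_diff F x A -> strict_diff G x B ->
  strict_diff (fun y => F y - G y) x (A - B).
Proof.
move=> FA GB e e0; have e20 : 0 < e / 2 by rewrite divr_gt0.
have [d1 d10 Fd] := FA _ e20; have [d2 d20 Gd] := GB _ e20.
exists (Num.min d1 d2) => [|a b]; first by rewrite lt_min d10.
rewrite !lt_min => /andP[a1 a2] /andP[b1 b2].
have -> : F a - G a - (F b - G b) - (a - b) *m (A - B) =
   (F a - F b - (a - b) *m A) - (G a - G b - (a - b) *m B).
  rewrite mulmxBr; move: ((a - b) *m A) ((a - b) *m B) => u v.
  by apply/rowP => i; rewrite !mxE; ring.
apply: le_trans (ler_normB _ _) _; rewrite [e]splitr mulrDl.
by rewrite lerD ?Fd ?Gd.
Qed.

Lemma mulmxr_continuous m n (A : 'M[R]_(m, n)) (z : 'rV[R]_m) :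
  {for z, continuous (mulmxr A : 'rV[R]_m -> 'rV[R]_n)}.
Proof.
apply/(@cvgrPdist_le _ _ _ (nbhs (z : 'rV[R]_m))) => e e0.
have C0 : 0 < m%:R * `|A| + 1 by rewrite ltr_wpDl// mulr_ge0.
apply/(@nbhs_normP R 'rV[R]_m z).
exists (e / (m%:R * `|A| + 1)); first exact: divr_gt0.
move=> y /= zy; rewrite -mulmxBl; apply: le_trans (mulmx_norm_le _ _) _.
move: zy; rewrite ltr_pdivlMr// mulrC => /ltW; apply: le_trans.
by rewrite ler_wpM2r// lerDl.
Qed.

Lemma differentiable_increment (V W : normedModType R) (F : V -> W) (x : V) :
  differentiable F x -> forall e : R, 0 < e -> exists2 d : R, 0 < d &
    forall h, `|h| < d -> `|F (x + h) - F x - 'd F x h| <= e * `|h|.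
Proof.
move=> /diff_locally/eqaddoP dF e e0.
have /nbhs_normP[d /= d0 Fd] := dF e e0; exists d => // h hd.
by rewrite -addrA -opprD [x + h]addrC; apply: Fd; rewrite /ball_ /= sub0r normrN.
Qed.

Lemma differentiable_of_increment (V W : normedModType R) (F : V -> W) (x : V)
    (A : {linear V -> W}) :
  continuous A ->
  (forall e : R, 0 < e -> exists2 d : R, 0 < d &
    forall h, `|h| < d -> `|F (h + x) - F x - A h| <= e * `|h|) ->
  differentiable F x /\ 'd F x = A :> (V -> W).
Proof.
move=> cA FA.
have FE : F \o shift x = cst (F x) + A +o_ 0 id.
  apply/eqaddoP => e e0; have [d d0 Fd] := FA _ e0.
  apply/nbhs_normP; exists d => //= h; rewrite /ball_ /= sub0r normrN => hd.
  have := Fd _ hd; by rewrite -addrA -opprD.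
have dE := diff_unique cA FE.
by split=> //; apply/diff_locallyP; rewrite dE.
Qed.

Lemma strict_diff_jacobian m n (F : 'rV[R]_m -> 'rV[R]_n) x A :
  strict_diff F x A -> differentiable F x /\ 'J F x = A.
Proof.
move=> FA; have cA : continuous (mulmxr A : 'rV[R]_m -> 'rV[R]_n) by exact: mulmxr_continuous.
have [|dF dE] := @differentiable_of_increment _ _ F x (mulmxr A) cA.
  move=> e e0; have [d d0 Fd] := FA _ e0; exists d => // h hd.
  have := Fd (h + x) x; rewrite !addrK subrr normr0 /=; exact.
split=> //.
by apply/row_matrixP => i; rewrite !rowE /jacobian mul_rV_lin1 dE.
Qed.

(** Multiply the increment formula of F by invmx J; the Lipschitz bound on X turns
an error in `|X a - X b| into one in `|a - b|. *)
Lemma strict_diff_inverse n (F X : 'rV[R]_n -> 'rV[R]_n) y (J : 'M[R]_n) (K : R) :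
  0 < K -> (forall a b, `|X a - X b| <= K * `|a - b|) ->
  (forall a, F (X a) = a) -> J \in unitmx -> strict_diff F (X y) J ->
  strict_diff X y (invmx J).
Proof.
move=> K0 XK FX Ju FJ e e0.
pose C := n%:R * `|invmx J| + 1.
have C0 : 0 < C by rewrite ltr_wpDl// mulr_ge0.
have [d d0 Fd] := FJ (e / C / K) (divr_gt0 (divr_gt0 e0 C0) K0).
exists (d / K) => [|a b ad bd]; first by rewrite divr_gt0.
have Xd c : `|c - y| < d / K -> `|X c - X y| < d.
  by move=> cd; apply: le_lt_trans (XK _ _) _; rewrite mulrC -ltr_pdivlMr.
have -> : X a - X b - (a - b) *m invmx J =
    - ((F (X a) - F (X b) - (X a - X b) *m J) *m invmx J).
  by rewrite !FX [(_ - _ *m J) *m _]mulmxBl mulmxK// opprB.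
rewrite normrN; apply: le_trans (mulmx_norm_le _ _) _.
apply: (@le_trans _ _ (C * (e / C / K * (K * `|a - b|)))).
  apply: ler_pM; rewrite ?mulr_ge0// ?lerDl//.
  apply: le_trans (Fd _ _ (Xd _ ad) (Xd _ bd)) _.
  by rewrite ler_wpM2l// !divr_ge0// ltW.
by rewrite le_eqVlt; apply/orP; left; apply/eqP; field; rewrite !gt_eqF.
Qed.

Lemma strict_diff_expansive n (F : 'rV[R]_n -> 'rV[R]_n) x A :
  A \in unitmx -> strict_diff F x A -> exists2 d : R, 0 < d &
    exists2 K : R, 0 < K & forall a b, `|a - x| < d -> `|b - x| < d ->
      `|a - b| <= K * `|F a - F b|.
Proof.
move=> /unitmx_norm_ge[c c0 Ac] FA; have c20 : 0 < c / 2 by rewrite divr_gt0.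
have [d d0 Fd] := FA _ c20; exists d => //.
exists (c / 2)^-1 => [|a b ad bd]; first by rewrite invr_gt0.
rewrite ler_pdivlMl//; have := Fd _ _ ad bd; have := Ac (a - b).
have := ler_normB (F a - F b) (F a - F b - (a - b) *m A); rewrite opprB addrC subrK.
lra.
Qed.

(** The second difference of f over the parallelogram (t u, t v) is, by the mean
value theorem, t times an increment of the gradient over t v. *)
Lemma second_difference n (f : 'rV[R]_n -> R) x (H : 'M[R]_n) (u v : 'rV[R]_n) e :
  (forall y, differentiable f y) -> strict_diff (grad f) x H -> 0 < e ->
  exists2 d : R, 0 < d & forall t : R, 0 < t < d ->
    `|f (x + t *: v + t *: u) - f (x + t *: u) - (f (x + t *: v) - f x)
       - t ^+ 2 * dotv (v *m H) u| <= e * t ^+ 2.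
Proof.
move=> df gH e0.
pose C := n%:R * `|v| * `|u| + 1.
have C0 : 0 < C by rewrite ltr_wpDl// !mulr_ge0.
have [d d0 gd] := gH _ (divr_gt0 e0 C0).
pose S := `|u| + `|v| + 1; have S0 : 0 < S by rewrite ltr_wpDl// addr_ge0.
exists (d / S) => [|t /andP[t0 td]]; first by rewrite divr_gt0.
have tS : t * (`|u| + `|v|) < d.
  move: td; rewrite ltr_pdivlMr//; apply: le_lt_trans.
  by rewrite ler_pM2l// lerDl.
pose h s := f (x + t *: v + s *: u) - f (x + s *: u).
have [s _|s /andP[s0 st]] := @MVT_from0 h
    (fun s => dotv (grad f (x + t *: v + s *: u)) u - dotv (grad f (x + s *: u)) u) _ t0.
  by apply: is_deriveB; apply: is_derive_line_grad.
rewrite /h !scale0r !addr0 => ->.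
set g1 := grad f _; set g2 := grad f _.
have near1 : `|x + t *: v + s *: u - x| < d.
  apply: le_lt_trans tS; rewrite addrC !addrA addNr add0r.
  apply: le_trans (ler_normD _ _) _; rewrite !normrZ !ger0_norm ?(ltW t0)//.
  by have := ler_wpM2r (normr_ge0 u) st; lra.
have near2 : `|x + s *: u - x| < d.
  apply: le_lt_trans tS; rewrite addrAC subrr add0r normrZ ger0_norm//.
  have := ler_wpM2r (normr_ge0 u) st; have := mulr_ge0 (ltW t0) (normr_ge0 v); lra.
have := gd _ _ near1 near2; rewrite -/g1 -/g2.
have -> : x + t *: v + s *: u - (x + s *: u) = t *: v.
  by apply/rowP => i; rewrite !mxE; ring.
rewrite -scalemxAl => gb.
have -> : (dotv g1 u - dotv g2 u) * t - t ^+ 2 * dotv (v *m H) u =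
    t * dotv (g1 - g2 - t *: (v *m H)) u.
  by rewrite !dotvBl dotvZl; ring.
rewrite normrM (gtr0_norm t0).
apply: (@le_trans _ _ (t * (n%:R * (e / C * (t * `|v|)) * `|u|))).
  rewrite ler_pM2l//; apply: le_trans (dotv_norm_le _ _) _.
  by rewrite ler_wpM2r// ler_wpM2l//; apply: le_trans gb _; rewrite normrZ gtr0_norm.
have -> : t * (n%:R * (e / C * (t * `|v|)) * `|u|) =
   e / C * (n%:R * `|v| * `|u|) * t ^+ 2 by ring.
rewrite ler_wpM2r ?sqr_ge0// mulrAC ler_pdivrMr// ler_pM2l// lerDl//.
Qed.

(** Schwarz's theorem: the second difference is symmetric in u and v, and it
determines <v H, u> in the limit. *)
Lemma hessian_symmetric n (f : 'rV[R]_n -> R) x (H : 'M[R]_n) :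
  (forall y, differentiable f y) -> strict_diff (grad f) x H -> H^T = H.
Proof.
move=> df gH.
suff sym u v : dotv (v *m H) u = dotv (u *m H) v.
  apply/matrixP => i j; have := sym (delta_mx 0 i) (delta_mx 0 j).
  by rewrite !dotv_delta -!rowE !mxE.
apply/eqP; rewrite -subr_eq0 -normr_le0; apply/ler_addgt0Pr => e e0; rewrite add0r.
have e20 : 0 < e / 2 by rewrite divr_gt0.
have [d1 d10 D1] := second_difference u v df gH e20.
have [d2 d20 D2] := second_difference v u df gH e20.
pose t := Num.min d1 d2 / 2.
have t0 : 0 < t by rewrite divr_gt0// lt_min d10.
have tm : t < Num.min d1 d2 by rewrite /t ltr_pdivrMr// ltr_pMr ?ltr1n// lt_min d10.
have [t1 t2] : t < d1 /\ t < d2 by move: tm; rewrite lt_min => /andP.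
have := D1 t; rewrite t0 t1 => /(_ isT).
have := D2 t; rewrite t0 t2 => /(_ isT).
rewrite [x + t *: u + t *: v]addrAC; set p := f (x + _ + _).
set q := f (x + t *: u); set r := f (x + t *: v).
move=> Du Dv.
have /ler_pM2l <- : 0 < t ^+ 2 by rewrite exprn_gt0.
rewrite -{1}(ger0_norm (sqr_ge0 t)) -normrM.
set a := dotv _ _ in Dv *; set b := dotv _ _ in Du *.
have -> : t ^+ 2 * (a - b) = (p - r - (q - f x) - t ^+ 2 * b) - (p - q - (r - f x) - t ^+ 2 * a).
  by ring.
by apply: le_trans (ler_normB _ _) _; lra.
Qed.

End StrictDifferentiability.

(** * The conjugate of a reference function *)

Section ReferenceConjugate.
Set Implicit Arguments.
Unset Strict Implicit.
Context {R : realType}.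

Context {n : nat} (phi : 'rV[R]_n -> \bar R) (phi_ref : reference_function phi).
Let p := fine \o phi.
Let D := edom phi.
Let U := interior D.

Let pE x : D x -> phi x = (p x)%:E.
Proof.
have [[_ /(_ x) pN] _ _ _ _] := phi_ref.
by rewrite /D /edom /= /p /= => pP; rewrite fineK// fin_numE gt_eqF// lt_eqF.
Qed.

Let D0 : D 0.
Proof. by have [_ _ _ _ p0] := phi_ref; rewrite /D /edom /= p0 ltry. Qed.

Definition convexity_modulus (mu : R) := 0 < mu /\
  forall x y (t : R), D x -> D y -> 0 <= t <= 1 ->
    D (t *: x + (1 - t) *: y) /\
    p (t *: x + (1 - t) *: y) <= t * p x + (1 - t) * p y
      - mu / 2 * t * (1 - t) * dotv (x - y) (x - y).

Lemma reference_modulus : exists mu, convexity_modulus mu.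
Proof.
have [_ _ [mu mu0 sc] _ _] := phi_ref; exists mu; split=> // x y t Dx Dy t01.
have := sc x y t t01; rewrite (pE Dx) (pE Dy) enorm_sqr => scxy.
have Dz : D (t *: x + (1 - t) *: y).
  by rewrite /D /edom /=; apply: le_lt_trans scxy _; rewrite ltry.
by split=> //; move: scxy; rewrite (pE Dz) lee_fin.
Qed.

Context (mu : R) (muP : convexity_modulus mu).

(** Strong convexity between x and - x, whose midpoint is 0 where phi vanishes. *)
Lemma reference_ge_quadratic x : D x -> mu / 2 * dotv x x <= p x.
Proof.
have [mu0 conv] := muP.
move=> Dx; have [_ _ _ ev p0] := phi_ref.
have DNx : D (- x) by rewrite /D /edom /= ev.
have half : 0 <= (2^-1 : R) <= 1 by lra.
have [_] := conv _ _ _ Dx DNx half.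
have -> : 2^-1 *: x + (1 - 2^-1) *: - x = 0.
  by apply/rowP => i; rewrite !mxE; field.
have -> : p (- x) = p x by rewrite /p /= ev.
rewrite {1}/p /= p0 /= opprK dotvDl !dotvDr; lra.
Qed.

(** Such x attain the supremum that defines the conjugate at y. *)
Definition tilted_min y x :=
  D x /\ forall z, D z -> p x - dotv x y <= p z - dotv z y.

(** A minimizing sequence is bounded by quadratic growth, and any cluster point
of it is a minimizer by lower semicontinuity. *)
Lemma tilted_min_exists y : exists x, tilted_min y x.
Proof.
have [mu0 conv] := muP.
pose h z : R := p z - dotv z y.
pose c : R := n%:R * `|y|.
have c0 : 0 <= c by rewrite mulr_ge0.
have hlow z : D z -> mu / 2 * `|z| ^+ 2 - c * `|z| <= h z.
  move=> Dz; have := reference_ge_quadratic Dz; have := dotvv_ge z.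
  have := ler_norm (dotv z y); have := dotv_norm_le z y.
  rewrite /h /c => h1 h2 h3; have mu2 : 0 <= mu / 2 by rewrite divr_ge0// ltW.
  have := ler_wpM2l mu2 h3; lra.
pose S := h @` D.
have hinf : has_inf S.
  split; first by exists (h 0), 0.
  exists (- (c ^+ 2 / (2 * mu))) => _ [z Dz <-]; apply: le_trans (hlow _ Dz).
  have -> : mu / 2 * `|z| ^+ 2 - c * `|z| =
    mu / 2 * (`|z| - c / mu) ^+ 2 - c ^+ 2 / (2 * mu) by field; rewrite gt_eqF.
  by rewrite lerDr mulr_ge0 ?sqr_ge0// divr_ge0// ltW.
pose m := inf S.
have mlow z : D z -> m <= h z by move=> Dz; apply: ge_inf => //; [case: hinf|exists z].
have zP k : {z | D z /\ h z < m + k.+1%:R^-1}.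
  apply/cid; have k0 : (0 : R) < k.+1%:R^-1 by rewrite invr_gt0.
  by have [_ [z Dz <-] hz] := inf_adherent k0 hinf; exists z.
pose z k := projT1 (zP k).
have Dz k : D (z k) by rewrite /z; case: (zP k) => ? [].
have hz k : h (z k) < m + k.+1%:R^-1 by rewrite /z; case: (zP k) => ? [].
have am0 : 0 <= `|m| by [].
(* Any z with h z < m + 1 has norm at most M: beyond it the quadratic term
   exceeds c `|z| + m + 1. *)
pose M : R := 2 * (c + `|m| + 1 + mu) / mu.
have M1 : 0 < M by rewrite divr_gt0// mulr_gt0//; lra.
have zM k : `|z k| <= M.
  rewrite leNgt; apply/negP => Mz.
  have := hlow _ (Dz k); have := hz k.
  have : (k.+1%:R : R)^-1 <= 1 by rewrite invf_le1// ler1n.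
  have := ler_norm m.
  have : c + `|m| + 1 + mu < mu / 2 * `|z k|.
    by move: Mz; rewrite /M ltr_pdivrMr//; lra.
  set a := `|z k| => a1 a2 a3 a4 a5.
  have age : 2 < a.
    by apply: le_lt_trans Mz; rewrite ler_pdivlMr//; lra.
  have : (c + `|m| + 1 + mu) * a < mu / 2 * a * a by rewrite ltr_pM2r//; lra.
  have : 0 <= (`|m| + 1 + mu) * (a - 1) by rewrite mulr_ge0//; lra.
  have -> : mu / 2 * a * a = mu / 2 * a ^+ 2 by ring.
  by move: a3 a4 a5; move: (h _) (k.+1%:R^-1) => hk v; lra.
have Kc : compact [set x : 'rV[R]_n | `|x| <= M].
  apply: bounded_closed_compact.
    by exists M; split; [exact: num_real|move=> t Mt x /= /le_trans; apply; exact: ltW].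
  apply: (@preimage_closed 'rV[R]_n R Num.norm _ _ (@closed_le R M)) => w _.
  exact: (@norm_continuous _ 'rV[R]_n).
have [|x [_ xcl]] := Kc (z @ \oo) _; first by exists 0%N => // k _ /=; exact: zM.
have hx : (phi x <= (m + dotv x y)%:E)%E.
  rewrite leNgt; apply/negP => lt.
  have [a a1 a2] : exists2 a, m + dotv x y < a & (a%:E < phi x)%E.
    case: (phi x) lt => [r| |]//.
    - rewrite lte_fin => lt; exists ((m + dotv x y + r) / 2); rewrite ?lte_fin; lra.
    - by exists (m + dotv x y + 1); rewrite ?ltry//; lra.
  have [_ lsc _ _ _] := phi_ref.
  have [V Vx Va] := lsc _ _ a2.
  pose d : R := a - (m + dotv x y); have d0 : 0 < d by rewrite subr_gt0.
  have [N N1] : exists N, forall k, (N <= k)%N -> (k.+1%:R : R)^-1 < d / 2.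
    exists (Num.truncn (2 / d)) => k Nk.
    rewrite -[d / 2]invrK ltf_pV2 ?posrE ?invr_gt0 ?divr_gt0//.
    rewrite invf_div; apply: lt_le_trans (truncnS_gt _) _.
    by rewrite ler_nat ltnS.
  pose B := [set w : 'rV[R]_n | `|x - w| < d / 2 / (c + 1)].
  have cc : 0 < c + 1 by rewrite ltr_wpDl.
  have xB : nbhs x B.
    by apply/rv_nbhsP; exists (d / 2 / (c + 1)) => //; rewrite !divr_gt0.
  have := xcl (z @` [set k | (N <= k)%N]) (V `&` B).
  case.
  - by exists N => // k Nk /=; exists k.
  - exact: filterI.
  move=> _ [[k Nk <-] [Vk Bk]].
  have := Va _ Vk; rewrite (pE (Dz k)) lte_fin => pa.
  have := hz k; have := N1 _ Nk; rewrite /h => h1 h2.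
  have : dotv (z k - x) y <= d / 2.
    apply: le_trans (ler_norm _) _; apply: le_trans (dotv_norm_le _ _) _.
    move: Bk; rewrite /B /= ltr_pdivlMr// distrC => /ltW; apply: le_trans.
    by rewrite mulrAC mulrC ler_wpM2l// lerDl.
  by rewrite dotvBl; move: h1 h2; move: (_^-1 : R) => v; rewrite /d; lra.
have Dx : D x by rewrite /D /edom /=; apply: le_lt_trans hx _; rewrite ltry.
exists x; split=> // w Dw; apply: le_trans (mlow _ Dw).
by move: hx; rewrite (pE Dx) lee_fin; lra.
Qed.

(** A first-order lower bound at x along the segment to z, inserted in the strong
convexity inequality and divided by t, gives the global quadratic bound as t
tends to 0. It serves both for minimizers, where g is the tilt, and for
interior points, where g is the gradient. *)
Lemma strong_subgradient x g z : D x -> D z ->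
  (forall e : R, 0 < e -> exists2 d : R, 0 < d & forall t : R, 0 < t < d ->
    p x + t * (dotv (z - x) g - e) <= p (x + t *: (z - x))) ->
  p x + dotv (z - x) g + mu / 2 * dotv (z - x) (z - x) <= p z.
Proof.
have [mu0 conv] := muP.
move=> Dx Dz sub; apply/ler_addgt0Pr => e e0.
set Q := dotv (z - x) (z - x); have Q0 : 0 <= Q by exact: dotvv_ge0.
have e20 : 0 < e / 2 by rewrite divr_gt0.
have [d d0 dP] := sub _ e20.
pose k : R := mu / 2 * Q; have k0 : 0 <= k by rewrite mulr_ge0// divr_ge0// ltW.
have k10 : 0 < k + 1 by lra.
pose t : R := Num.min (Num.min (1 / 2) (d / 2)) (e / 2 / (k + 1)).
have t0 : 0 < t by rewrite !lt_min !divr_gt0.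
have : t <= t by []; rewrite {2}/t !le_min => /andP[/andP[t1 t2]].
rewrite ler_pdivlMr// => t3.
have td : 0 < t < d by lra.
have t01 : 0 <= t <= 1 by lra.
have := dP t td; have [_] := conv _ _ _ Dz Dx t01.
have -> : t *: z + (1 - t) *: x = x + t *: (z - x).
  by apply/rowP => i; rewrite !mxE; ring.
rewrite -/Q => c1 c2.
rewrite -(ler_pM2l t0).
have kt : t * (t * k) <= t * (e / 2) by rewrite ler_pM2l//; lra.
rewrite /k in kt *; lra.
Qed.

Lemma tilted_min_strong x y z : tilted_min y x -> D z ->
  p x + dotv (z - x) y + mu / 2 * dotv (z - x) (z - x) <= p z.
Proof.
have [mu0 conv] := muP.
move=> [Dx xmin] Dz; apply: strong_subgradient => // e e0; exists 1 => // t t01.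
have t01' : 0 <= t <= 1 by lra.
have [Dt _] := conv _ _ _ Dz Dx t01'.
have := xmin _ Dt.
have -> : t *: z + (1 - t) *: x = x + t *: (z - x).
  by apply/rowP => i; rewrite !mxE; ring.
rewrite dotvDl dotvZl; have : 0 <= t * e by rewrite mulr_ge0//; lra.
lra.
Qed.

Context (phi_S : conditionS phi).

Let pC2 : C2_on U p. Proof. by have [] := phi_S. Qed.

Let UD x : U x -> D x. Proof. exact: interior_subset. Qed.

Lemma gradient_strong x z : U x -> D z ->
  p x + dotv (z - x) (grad p x) + mu / 2 * dotv (z - x) (z - x) <= p z.
Proof.
have [mu0 conv] := muP.
move=> Ux Dz; have [dp _ _] := pC2; apply: strong_subgradient => // [|e e0].
  exact: UD.
pose K : R := `|z - x| + 1; have K0 : 0 < K by rewrite ltr_wpDl.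
have [d d0 dP] := differentiable_increment (dp _ Ux) (divr_gt0 e0 K0).
exists (d / K) => [|t /andP[t0 td]]; first by rewrite divr_gt0.
have tK : t * `|z - x| < d.
  by move: td; rewrite ltr_pdivlMr//; apply: le_lt_trans; rewrite ler_pM2l// lerDl.
have := dP (t *: (z - x)); rewrite normrZ gtr0_norm// => /(_ tK).
rewrite (diff_gradE _ (dp _ Ux)) dotvZr dotvC => /ler_normlP[+ _].
suff : e / K * (t * `|z - x|) <= t * e by lra.
have -> : e / K * (t * `|z - x|) = t * e * (`|z - x| / K) by ring.
by rewrite ler_piMr ?mulr_ge0 ?(ltW t0) ?(ltW e0)// ler_pdivrMr// mul1r lerDl.
Qed.

(** If the minimizer x of h = phi - <., y> were on the boundary, approach it along
the segment from an interior point u0. There the gradients g of h satisfy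
<g, u0 - x> >= 0 by minimality, so the gradient inequality at the finitely many
points u0 +- r' e_i bounds every coordinate of g, contradicting the blow-up. *)
Lemma tilted_min_interior x y : tilted_min y x -> U x.
Proof.
have [mu0 conv] := muP.
move=> xmin; have [Dx xm] := xmin; apply: contrapT => NUx.
have [[u0 Uu0] _ blow] := phi_S.
have /rv_nbhsP[r r0 rD] : nbhs u0 D by exact: Uu0.
pose t k : R := k.+1%:R^-1.
have t0 k : 0 < t k by rewrite invr_gt0.
have t1 k : t k <= 1 by rewrite invf_le1// ler1n.
pose u k := t k *: u0 + (1 - t k) *: x.
have Uu k : U (u k).
  apply/rv_nbhsP; exists (t k * r); first by rewrite mulr_gt0.
  move=> w /= uw.
  have -> : w = t k *: (u0 + (t k)^-1 *: (w - u k)) + (1 - t k) *: x.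
    by apply/rowP => i; rewrite !mxE; field; rewrite gt_eqF.
  have tk : 0 <= t k <= 1 by rewrite ltW/=.
  suff Dw : D (u0 + (t k)^-1 *: (w - u k)) by exact: (conv _ _ _ Dw Dx tk).1.
  apply: rD; rewrite /= opprD addrA subrr add0r normrN normrZ gtr0_norm ?invr_gt0//.
  by rewrite ltr_pdivrMl// distrC.
have ucv : u @ \oo --> x.
  have -> : u = (fun k => x + t k *: (u0 - x)).
    by apply/funext => k; apply/rowP => i; rewrite !mxE; ring.
  rewrite -[X in _ --> X]addr0 -(scale0r (u0 - x)).
  apply: cvgD; first exact: cvg_cst.
  by apply: cvgZr_tmp; exact: cvg_harmonic.
have xcl : (closure U `\` U) x.
  split=> // B xB; have [N _ NB] := ucv _ xB.
  by exists (u N); split=> //; apply: NB => /=.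
have /cvgryPge blowup := blow u x Uu xcl ucv.
pose h z : R := p z - dotv z y.
pose r' := r / 2; have r'0 : 0 < r' by rewrite divr_gt0.
have Dz (s : R) i : `|s| = r' -> D (u0 + s *: delta_mx 0 i).
  move=> sr; apply: rD; rewrite /= opprD addrA subrr add0r normrN normrZ sr.
  have d1 : `|delta_mx 0 i : 'rV[R]_n| <= 1.
    apply: rv_norm_le => // j; rewrite mxE eqxx /=.
    by case: (j == i); rewrite ?normr1 ?normr0.
  apply: le_lt_trans (ler_wpM2l (ltW r'0) d1) _; rewrite /r'; lra.
pose zz (s : R) i : 'rV[R]_n := u0 + s *: delta_mx 0 i.
pose C : R := \sum_i (`|h (zz r' i)| + `|h (zz (- r') i)|) + `|h x|.
have C0 : 0 <= C by rewrite addr_ge0// sumr_ge0// => i _; rewrite addr_ge0.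
have gb k : `|grad p (u k) - y| <= C / r'.
  apply: rv_norm_le => [|i]; first by rewrite divr_ge0// ltW.
  set g := grad p (u k) - y.
  have gineq z : D z -> h (u k) + dotv (z - u k) g <= h z.
    move=> Dz'; have := gradient_strong (Uu k) Dz'.
    have : 0 <= mu / 2 * dotv (z - u k) (z - u k).
      by rewrite mulr_ge0 ?dotvv_ge0// divr_ge0// ltW.
    rewrite /h /g dotvBr [dotv (_ - _) y]dotvBl; lra.
  have hux : h x <= h (u k) by apply/xm/UD/Uu.
  have dir : 0 <= dotv (u0 - x) g.
    have := gineq _ Dx; have -> : x - u k = - t k *: (u0 - x).
      by apply/rowP => j; rewrite !mxE; ring.
    rewrite dotvZl -(pmulr_rge0 _ (t0 k)); lra.
  have main s : `|s| = r' -> s * g 0 i <= h (zz s i) - h x.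
    move=> sr; have := gineq _ (Dz _ i sr); rewrite -/(zz s i).
    have -> : zz s i - u k = (1 - t k) *: (u0 - x) + s *: delta_mx 0 i.
      by apply/rowP => j; rewrite !mxE; ring.
    rewrite dotvDl !dotvZl (dotvC (delta_mx 0 i)) dotv_delta.
    have : 0 <= (1 - t k) * dotv (u0 - x) g by rewrite mulr_ge0// subr_ge0.
    lra.
  have hC s : `|s| = r' -> (s = r' \/ s = - r') -> h (zz s i) - h x <= C.
    move=> _ sr; rewrite /C (bigD1 i)//=.
    have := ler_norm (h (zz s i)); have := ler_norm (- h x); rewrite normrN.
    set S := \sum_(_ | _) _; have S0 : 0 <= S by rewrite sumr_ge0// => j _; rewrite addr_ge0.
    have := normr_ge0 (h (zz r' i)); have := normr_ge0 (h (zz (- r') i)).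
    case: sr => ->; lra.
  have P : `|r'| = r' by rewrite gtr0_norm.
  rewrite ler_pdivlMr// -{1}P -normrM mulrC ler_norml; apply/andP; split.
    have := main (- r'); have := hC (- r').
    rewrite normrN P => /(_ erefl (or_intror erefl)) ? /(_ erefl).
    lra.
  have := main r'; have := hC r'; rewrite P => /(_ erefl (or_introl erefl)) ? /(_ erefl); lra.
pose B : R := C / r' + `|y|.
have gB k : `|grad p (u k)| <= B.
  rewrite -(subrK y (grad p (u k))); apply: le_trans (ler_normD _ _) _.
  by rewrite lerD2r gb.
have [N _ /(_ N (leqnn N))] := blowup (Num.sqrt (n%:R * B ^+ 2) + 1).
rewrite /= leNgt => /negP; apply; apply: (@le_lt_trans _ _ (Num.sqrt (n%:R * B ^+ 2))).
  rewrite ler_wsqrtr//; apply: le_trans (ler_norm _) _.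
  apply: le_trans (dotv_norm_le _ _) _; rewrite -mulrA ler_wpM2l// expr2.
  by apply: ler_pM.
by rewrite ltrDl.
Qed.

(** Fermat's rule at an interior minimizer, tested in the direction of
y - grad p x. *)
Lemma tilted_min_gradient x y : tilted_min y x -> grad p x = y.
Proof.
move=> xmin; have Ux := tilted_min_interior xmin; have [dp _ _] := pC2.
have [Dx xm] := xmin; apply/esym/eqP; rewrite -subr_eq0 -normr_le0.
apply/ler_addgt0Pr => e e0; rewrite add0r; set w := y - grad p x.
have [-> |w0] := eqVneq w 0; first by rewrite normr0 ltW.
have wn0 : 0 < `|w| by rewrite normr_gt0.
have [d d0 dP] := differentiable_increment (dp _ Ux) e0.
have /rv_nbhsP[r r0 rD] : nbhs x D by exact: Ux.
pose t : R := Num.min d r / 2 / `|w|.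
have m0 : 0 < Num.min d r by rewrite lt_min d0.
have t0 : 0 < t by rewrite !divr_gt0.
have tw : `|t *: w| < Num.min d r.
  rewrite normrZ gtr0_norm// /t divfK ?gt_eqF//; lra.
move: tw; rewrite lt_min => /andP[twd twr].
have Dxt : D (x + t *: w) by apply: rD; rewrite opprD addrA subrr add0r normrN.
have := xm _ Dxt; have := dP _ twd.
rewrite (diff_gradE _ (dp _ Ux)) => /ler_normlP[_ h1].
rewrite dotvDl => h2.
have : dotv (t *: w) w <= e * `|t *: w|.
  by rewrite {2}/w dotvBr [dotv _ (grad p x)]dotvC; lra.
rewrite dotvZl normrZ gtr0_norm// mulrCA ler_pM2l// => h3.
by have := le_trans (dotvv_ge w) h3; rewrite expr2 ler_pM2r.
Qed.

(** Add the strong minimality inequalities of x and x' against each other. *)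
Lemma tilted_min_lipschitz x x' y y' : tilted_min y x -> tilted_min y' x' ->
  mu * `|x - x'| <= n%:R * `|y - y'|.
Proof.
move=> xm xm'; have [mu0 _] := muP; have [Dx _] := xm; have [Dx' _] := xm'.
have [-> |xx] := eqVneq x x'; first by rewrite subrr normr0 mulr0 mulr_ge0.
have xx0 : 0 < `|x - x'| by rewrite normr_gt0 subr_eq0.
rewrite -(ler_pM2r xx0).
have : mu * dotv (x - x') (x - x') <= dotv (y - y') (x - x').
  have := tilted_min_strong xm Dx'; have := tilted_min_strong xm' Dx.
  rewrite -(opprB x x') !dotvNl !dotvNr !opprK.
  rewrite [dotv (y - y') _]dotvC [dotv _ (y - y')]dotvBr; lra.
move=> h; apply: le_trans (le_trans h _); first by rewrite -mulrA -expr2 ler_pM2l// dotvv_ge.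
by apply: le_trans (ler_norm _) _; exact: dotv_norm_le.
Qed.

Lemma conjugate_tilted_min x y : tilted_min y x ->
  rconjugate phi y = dotv x y - p x.
Proof.
move=> [Dx xm]; rewrite /rconjugate /=.
suff -> : conjugate phi y = (dotv x y - p x)%:E by [].
apply/eqP; rewrite eq_le; apply/andP; split.
  apply: ge_ereal_sup => _ [z _ <-].
  have [Dz|NDz] := pselect (D z).
    by rewrite (pE Dz) -EFinB lee_fin; have := xm _ Dz; lra.
  have -> : phi z = +oo%E.
    by apply/eqP; rewrite -leye_eq leNgt; apply/negP.
  by rewrite /= leNye.
apply: le_ereal_sup_tmp; exists ((dotv x y)%:E - phi x)%E; first by exists x.
by rewrite (pE Dx).
Qed.

Definition conjugate_argmin y := projT1 (cid (tilted_min_exists y)).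

Local Notation X := conjugate_argmin.

Lemma conjugate_argminP y : tilted_min y (X y).
Proof. exact: projT2 (cid (tilted_min_exists y)). Qed.

(** The envelope theorem: each of the two minimizers is a competitor for the other
one, which encloses the increment of phi^* between t <X y, v> and t <X y', v>. *)
Lemma grad_conjugate y : grad (rconjugate phi) y = X y.
Proof.
have [mu0 _] := muP.
apply/rowP => i; rewrite mxE; set v : 'rV[R]_n := delta_mx 0 i.
rewrite -(dotv_delta (X y)) -/v /derive; apply/cvg_lim => //.
apply/cvgrPdist_le => e e0.
pose K : R := n%:R * (n%:R / mu * `|v|) * `|v| + 1.
have K0 : 0 < K by rewrite ltr_wpDl// !mulr_ge0// invr_ge0 ltW.
near=> t.
have t0 : t != 0 by near: t; exact: nbhs_dnbhs_neq.
have te : `|t| < e / K by near: t; apply: dnbhs0_lt; rewrite divr_gt0.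
rewrite /=; set y' := t *: v + y.
rewrite (conjugate_tilted_min (conjugate_argminP y)).
rewrite (conjugate_tilted_min (conjugate_argminP y')).
have [Dx xm] := conjugate_argminP y; have [Dx' xm'] := conjugate_argminP y'.
have a1 := xm _ Dx'; have a2 := xm' _ Dx.
have a3 := tilted_min_lipschitz (conjugate_argminP y') (conjugate_argminP y).
set q := (X in _ *: X).
have q1 : 0 <= q - t * dotv (X y) v.
  rewrite /q; move: a2; rewrite /y' !dotvDr !dotvZr; lra.
have q2 : q - t * dotv (X y) v <= t * dotv (X y' - X y) v.
  rewrite /q dotvBl; move: a1; rewrite /y' !dotvDr !dotvZr; lra.
have -> : dotv (X y) v - t^-1 *: q = - (t^-1 * (q - t * dotv (X y) v)).
  by rewrite /GRing.scale /=; field.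
rewrite normrN normrM normfV (ger0_norm q1) ler_pdivrMl ?normr_gt0//.
apply: le_trans q2 _; apply: le_trans (ler_norm _) _; rewrite normrM ler_pM2l ?normr_gt0//.
apply: le_trans (dotv_norm_le _ _) _.
have : `|X y' - X y| <= n%:R / mu * `|v| * `|t|.
  rewrite -mulrA [n%:R / mu]mulrC -mulrA ler_pdivlMl//; apply: le_trans a3 _.
  by rewrite /y' addrK normrZ [_ * `|v|]mulrC.
move=> a4; apply: (@le_trans _ _ (K * `|t|)).
  rewrite /K mulrDl mul1r.
  apply: (@le_trans _ _ (n%:R * (n%:R / mu * `|v|) * `|v| * `|t|)); last first.
    by rewrite lerDl.
  have -> : n%:R * (n%:R / mu * `|v|) * `|v| * `|t| =
      n%:R * (n%:R / mu * `|v| * `|t|) * `|v| by ring.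
  by rewrite ler_wpM2r// ler_wpM2l.
by rewrite mulrC -ler_pdivlMr// ltW.
Unshelve. all: by end_near. Qed.

(** Strong convexity makes grad p expand distances by mu near x, so its derivative
has no kernel. *)
Lemma hessian_unitmx x : U x -> hessian p x \in unitmx.
Proof.
move=> Ux; have [mu0 _] := muP; have [dp dg cH] := pC2.
apply: unitmx_ker => u uH; apply/eqP; rewrite -normr_le0 leNgt; apply/negP => u0.
pose e : R := mu / (2 * (n%:R + 1)).
have n0 : 0 < (n%:R : R) + 1 by rewrite ltr_wpDl.
have e0 : 0 < e by rewrite divr_gt0// mulr_gt0.
have [d d0 dP] := differentiable_increment (dg _ Ux) e0.
have /rv_nbhsP[r r0 rU] : nbhs x U by apply: nbhs_interior; exact: Ux.
have m0 : 0 < Num.min d r by rewrite lt_min d0.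
pose t : R := Num.min d r / 2 / `|u|.
have t0 : 0 < t by rewrite !divr_gt0.
have tu : `|t *: u| < Num.min d r.
  rewrite normrZ gtr0_norm// /t divfK ?gt_eqF//; lra.
move: tu; rewrite lt_min => /andP[tud tur].
have Uxt : U (x + t *: u) by apply: rU; rewrite opprD addrA subrr add0r normrN.
have := dP _ tud.
have -> : 'd (grad p) x (t *: u) = 0.
  have du : 'd (grad p) x u = 0 by rewrite -mul_rV_lin1; exact: uH.
  by rewrite linearZ /= du scaler0.
rewrite subr0; set dF := grad p _ - _ => dFe.
have := gradient_strong Ux (UD Uxt); have := gradient_strong Uxt (UD Ux).
have -> : x - (x + t *: u) = - (t *: u) by rewrite opprD addrA subrr add0r.
have -> : x + t *: u - x = t *: u by rewrite addrAC subrr add0r.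
rewrite !dotvNl !dotvNr !opprK => s1 s2.
have : mu * dotv (t *: u) (t *: u) <= dotv (t *: u) dF.
  by rewrite /dF [dotv _ (_ - _)]dotvBr; lra.
have tu0 : 0 < `|t *: u| by rewrite normrZ mulr_gt0// normr_gt0 gt_eqF.
move=> s3; have : mu * `|t *: u| ^+ 2 <= n%:R * e * `|t *: u| ^+ 2.
  apply: le_trans (le_trans s3 _); first by rewrite ler_pM2l// dotvv_ge.
  apply: le_trans (ler_norm _) _; apply: le_trans (dotv_norm_le _ _) _.
  have -> : n%:R * e * `|t *: u| ^+ 2 = n%:R * `|t *: u| * (e * `|t *: u|) by ring.
  by rewrite ler_wpM2l// mulr_ge0.
rewrite ler_pM2r ?exprn_gt0// leNgt => /negP; apply.
rewrite /e mulrA ltr_pdivrMr ?mulr_gt0// mulrC ltr_pM2l//; lra.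
Qed.

Lemma grad_conjugate_strict_diff y :
  strict_diff (grad (rconjugate phi)) y (hessian (rconjugate phi) y).
Proof.
have [mu0 _] := muP; have [dp dg cH] := pC2.
have Ux z : U (X z) by exact: tilted_min_interior (conjugate_argminP z).
have gE : grad (rconjugate phi) = X by apply/funext => z; exact: grad_conjugate.
suff sX : strict_diff X y (invmx (hessian p (X y))).
  by rewrite /hessian gE (strict_diff_jacobian sX).2.
apply: (@strict_diff_inverse _ _ (grad p) _ _ _ ((n%:R + 1) / mu)).
- by rewrite divr_gt0// ltr_wpDl.
- move=> a b; rewrite mulrAC ler_pdivlMr// mulrC.
  apply: le_trans (tilted_min_lipschitz (conjugate_argminP a) (conjugate_argminP b)) _.
  by rewrite ler_wpM2r// lerDl.
- by move=> a; apply: tilted_min_gradient (conjugate_argminP a).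
- exact: hessian_unitmx.
- apply: C1_strict_diff; last exact: cH.
  by apply: filterS dg _; apply: nbhs_interior; exact: Ux.
Qed.

End ReferenceConjugate.

(** * Null sets and locally expansive maps *)

Section LocalNegligibility.
Set Implicit Arguments.
Unset Strict Implicit.
Context {R : realType}.

Lemma negligible_dim0 (V : normedModType R) s : negligible_dim s (@set0 V).
Proof.
move=> e e0; exists void, (fun=> 0), (fun=> 0); split=> //.
by case=> [_|[]//]; rewrite big_nil ltW.
Qed.

Lemma negligible_dim_bigcup_count (V : normedModType R) s (I : countType)
    (A : I -> set V) :
  (forall i, negligible_dim s (A i)) -> negligible_dim s (\bigcup_i A i).
Proof.
move=> nA.
apply: (@negligible_dim_sub _ _ _ _ (\bigcup_k oapp A set0 (unpickle k))).
  by move=> x [i _ Aix]; exists (pickle i) => //; rewrite pickleK.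
apply: negligible_dim_bigcup => k.
by case: (unpickle k) => [i|]; [exact: nA | exact: negligible_dim0].
Qed.

(** These countably many balls replace Lindelof arguments. *)
Definition rational_ball {n} (i : 'rV[rat]_n * nat) : set 'rV[R]_n :=
  [set y | `|y - map_mx ratr i.1| < i.2.+1%:R^-1].

Lemma rational_ball_basis n (x : 'rV[R]_n) (d : R) : 0 < d ->
  exists2 i, rational_ball i x &
    rational_ball i `<=` [set y | `|y - x| < d].
Proof.
move=> d0; pose k := Num.truncn (2 / d); pose r : R := k.+1%:R^-1.
have r0 : 0 < r by rewrite invr_gt0.
have rd : r < d / 2.
  rewrite -[d / 2]invrK ltf_pV2 ?posrE ?invr_gt0 ?divr_gt0//.
  by rewrite invf_div; exact: truncnS_gt.
have q_ j : {q : rat | ratr q \in `]x 0 j, x 0 j + r / 2[}.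
  by apply/cid; apply: rat_in_itvoo; rewrite ltrDl divr_gt0.
pose q : 'rV[rat]_n := \row_j projT1 (q_ j).
have xq : `|x - map_mx ratr q| < r.
  apply: (@le_lt_trans _ _ (r / 2)); last by lra.
  apply: rv_norm_le => [|j]; first by rewrite divr_ge0// ltW.
  rewrite !mxE; case: (q_ j) => qj /=; rewrite in_itv /= => /andP[? ?].
  by rewrite ler_norml; apply/andP; split; lra.
exists (q, k) => // y; rewrite /rational_ball /= -/r => yq.
rewrite -(subrK (map_mx ratr q) y) -addrA.
apply: le_lt_trans (ler_normD _ _) _; rewrite [X in _ + X]distrC; lra.
Qed.

Lemma negligible_dim_local n s (A : set 'rV[R]_n) :
  (forall x, A x -> exists2 d : R, 0 < d &
     negligible_dim s (A `&` [set y | `|y - x| < d])) ->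
  negligible_dim s A.
Proof.
move=> locA.
pose B i := [set y | negligible_dim s (A `&` rational_ball i) /\
                     (A `&` rational_ball i) y].
apply: (@negligible_dim_sub _ _ _ _ (\bigcup_i B i)) => [x Ax|].
  have [d d0 nd] := locA _ Ax; have [i xi id_] := rational_ball_basis x d0.
  exists i => //; split; last by split.
  by apply: negligible_dim_sub nd => y [Ay /id_].
apply: negligible_dim_bigcup_count => i.
have [nAi|NnAi] := pselect (negligible_dim s (A `&` rational_ball i)).
  by apply: negligible_dim_sub nAi => y [].
by apply: negligible_dim_sub (negligible_dim0 _ s) => y [].
Qed.

Definition locally_expansive {n} (T : 'rV[R]_n -> 'rV[R]_n) :=
  forall x, exists2 d : R, 0 < d & exists2 K : R, 0 < K &
    forall a b, `|a - x| < d -> `|b - x| < d -> `|a - b| <= K * `|T a - T b|.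

(** Near each point, negligible_dim_expansive applies to T itself. *)
Lemma negligible_dim_preimage n s (T : 'rV[R]_n -> 'rV[R]_n) (N : set 'rV[R]_n) :
  locally_expansive T -> negligible_dim s N -> negligible_dim s (T @^-1` N).
Proof.
move=> eT nN; apply: negligible_dim_local => x Nx.
have [d d0 [K K0 TK]] := eT x; exists d => //.
apply: (negligible_dim_expansive K0 (p := T)) => [a b [_ ax] [_ bx]|].
  exact: TK.
by apply: negligible_dim_sub nN => _ [a [Na _] <-].
Qed.

Lemma negligible_dim_preimage_iter n s (T : 'rV[R]_n -> 'rV[R]_n)
    (N : set 'rV[R]_n) k :
  locally_expansive T -> negligible_dim s N ->
  negligible_dim s [set x | N (iter k T x)].
Proof.
move=> eT; elim: k N => // k IH N nN.
by apply: (IH (T @^-1` N)); exact: negligible_dim_preimage.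
Qed.

Lemma lebesgue_null0 n : lebesgue_null (@set0 'rV[R]_n).
Proof.
apply/eqP; rewrite eq_le lebesgue_outer_ge0 andbT.
apply: ereal_inf_lbound; exists pred0, (fun=> 0), (fun=> 0); split=> //.
by rewrite eseries_pred0.
Qed.

End LocalNegligibility.

(** * Expanded cones and orbits that stay near a point *)

Section Cones.
Set Implicit Arguments.
Unset Strict Implicit.
Context {R : realType}.

Definition quad {n} (B : 'M[R]_n) (w : 'rV[R]_n) : R := dotv (w *m B) w.

Lemma bilinear_bound n (B : 'M[R]_n) : exists2 c : R, 0 <= c &
  forall u w : 'rV[R]_n, `|dotv (u *m B) w| <= c * `|u| * `|w|.
Proof.
exists (n%:R * (n%:R * `|B|)) => [|u w]; first by rewrite !mulr_ge0.
apply: le_trans (dotv_norm_le _ _) _; rewrite ler_wpM2r// -mulrA ler_wpM2l//.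
exact: mulmx_norm_le.
Qed.

Lemma quadD n (B : 'M[R]_n) (u w : 'rV[R]_n) :
  quad B (u + w) = quad B u + dotv (u *m B) w + dotv (w *m B) u + quad B w.
Proof. by rewrite /quad mulmxDl !dotvDl !dotvDr; ring. Qed.

Lemma quadZ n (B : 'M[R]_n) a (w : 'rV[R]_n) : quad B (a *: w) = a ^+ 2 * quad B w.
Proof. by rewrite /quad -scalemxAl dotvZl dotvZr expr2 mulrA. Qed.

(** Project along v onto the coordinate hyperplane x_i = 0, where v_i <> 0. Two
points of W cannot differ by a vector close to the direction of v, where quad B
is positive, so the projection is injective on W with Lipschitz inverse. Its
image is a bounded set of 'rV_m, negligible in dimension m.+1. *)
Lemma cone_free_negligible n (B : 'M[R]_n) (v : 'rV[R]_n) (W : set 'rV[R]_n) M :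
  0 < quad B v -> 0 < M -> (forall x, W x -> `|x| <= M) ->
  (forall x y, W x -> W y -> quad B (x - y) <= 0) -> negligible_dim n W.
Proof.
move=> qv M0 WM Wq.
have [i vi] : exists i, v 0 i != 0.
  apply: contrapT => vN; move: qv; suff -> : v = 0 by rewrite /quad dotvC dotv0l ltxx.
  apply/rowP => i; rewrite mxE; apply/eqP/negPn/negP => vi.
  by apply: vN; exists i.
case: n => [|m] in B v W qv WM Wq i vi *; first by case: i vi.
pose p (x : 'rV[R]_m.+1) : 'rV[R]_m :=
  \row_j (x - (x 0 i / v 0 i) *: v) 0 (lift i j).
have pB x y : p x - p y = p (x - y) by apply/rowP => j; rewrite !mxE; ring.
have [c c0 Bc] := bilinear_bound B.
pose C : R := 2 * c * `|v| + c; have C0 : 0 <= C by rewrite addr_ge0// mulr_ge0// mulr_ge0.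
pose K : R := C / quad B v + 1.
have K1 : 1 <= K by rewrite lerDr divr_ge0// ltW.
have slope w : quad B w <= 0 -> `|w| <= (1 + K * `|v|) * `|p w|.
  (* w = w' + s v, where w' has i-th coordinate 0 and otherwise is p w; if s were
     large compared to w', the term s ^ 2 quad B v would dominate quad B w. *)
  move=> qw; set s := w 0 i / v 0 i; set w' := w - s *: v.
  have w'p : `|w'| <= `|p w|.
    apply: rv_norm_le => // j; have [k ->|->] := unliftP i j; last first.
      by rewrite !mxE /s divfK// subrr normr0.
    by apply: le_trans (mx_coord_le_norm (p w) 0 _); rewrite [in leRHS]mxE.
  have sK : `|s| <= K * `|w'|.
    rewrite leNgt; apply/negP => Ks.
    have sw : `|w'| <= `|s|.
      by apply: le_trans (ltW Ks); rewrite ler_peMl.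
    have s0 : 0 < `|s| by apply: le_lt_trans Ks; rewrite mulr_ge0//; lra.
    have wE : w = w' + s *: v by rewrite subrK.
    move: qw; rewrite wE quadD quadZ -[s ^+ 2]real_normK ?num_real//.
    have := Bc w' (s *: v); have := Bc (s *: v) w'; have := Bc w' w'.
    rewrite normrZ -/(quad B w') => /ler_normlP[+ _] /ler_normlP[+ _] /ler_normlP[+ _].
    have : c * `|w'| * `|w'| <= c * `|w'| * `|s|.
      by rewrite ler_wpM2l// mulr_ge0.
    have : C * `|w'| * `|s| < quad B v * `|s| ^+ 2.
      rewrite expr2 mulrA ltr_pM2r//.
      apply: (@le_lt_trans _ _ (quad B v * (K * `|w'|))); last by rewrite ltr_pM2l.
      by rewrite mulrA ler_wpM2r// /K mulrDr mulr1 mulrCA divff ?gt_eqF// mulr1 lerDl ltW.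
    rewrite /C; lra.
  have -> : w = w' + s *: v by rewrite subrK.
  apply: le_trans (ler_normD _ _) _; rewrite subrK mulrDl mul1r lerD//.
  rewrite normrZ mulrAC ler_wpM2r//; apply: le_trans sK _.
  by rewrite ler_wpM2l//; lra.
have K0 : 0 < 1 + K * `|v| by rewrite ltr_wpDr// mulr_ge0//; lra.
apply: (negligible_dim_expansive K0 (p := p)) => [x y Wx Wy|].
  by rewrite pB; apply: slope; exact: Wq.
pose Q : R := 1 + `|v 0 i|^-1 * `|v|.
have Q0 : 0 < Q by rewrite ltr_wpDr// mulr_ge0.
apply: (@negligible_dim_bounded _ _ _ (Q * M)); first by rewrite mulr_gt0.
move=> _ [x Wx <-]; apply: (@le_trans _ _ (Q * `|x|)); last first.
  by rewrite ler_pM2l// WM.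
apply: rv_norm_le => [|j]; first by rewrite mulr_ge0// ltW.
rewrite mxE; apply: le_trans (mx_coord_le_norm _ 0 _) _.
apply: le_trans (ler_normB _ _) _; rewrite /Q mulrDl mul1r lerD2l normrZ normrM normfV.
rewrite [_ / _]mulrC mulrAC ler_wpM2l ?mulr_ge0//; exact: mx_coord_le_norm.
Qed.

(** For the linear map, quad B (w S) = e quad B w + |w B|^2, because S is symmetric
and commutes with B; the margin |w B|^2 >= r^2 |w|^2 absorbs the error terms of
the strict derivative once ep is small. *)
Lemma cone_expanded n (T : 'rV[R]_n -> 'rV[R]_n) x (S : 'M[R]_n) (e : R) :
  S^T = S -> strict_diff T x S -> S *m S - e%:M \in unitmx ->
  exists2 d : R, 0 < d & forall a b, `|a - x| < d -> `|b - x| < d ->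
    e * quad (S *m S - e%:M) (a - b) <= quad (S *m S - e%:M) (T a - T b).
Proof.
move=> Ssym TS; set B := S *m S - e%:M => Bu.
have [r r0 Br] := unitmx_norm_ge Bu; have [c c0 Bc] := bilinear_bound B.
pose k : R := n%:R * `|S|; have k0 : 0 <= k by rewrite mulr_ge0.
pose C : R := c * (2 * k + 1); have C0 : 0 <= C by rewrite mulr_ge0//; lra.
have C10 : 0 < C + 1 by lra.
pose ep : R := Num.min 1 (r ^+ 2 / (C + 1)).
have ep0 : 0 < ep by rewrite lt_min ltr01 divr_gt0// exprn_gt0.
have ep1 : ep <= 1 by rewrite ge_min lexx.
have epC : C * ep <= r ^+ 2.
  have : ep <= r ^+ 2 / (C + 1) by rewrite ge_min lexx orbT.
  rewrite ler_pdivlMr//; lra.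
have [d d0 Td] := TS _ ep0; exists d => // a b ad bd.
set w := a - b; set y := T a - T b - w *m S.
have -> : T a - T b = w *m S + y by rewrite [RHS]addrC subrK.
have yw : `|y| <= ep * `|w| by exact: Td.
have SB : S *m B = B *m S.
  by rewrite mulmxBr mulmxBl mulmxA scalar_mxC.
have qS : quad B (w *m S) = e * quad B w + dotv (w *m B) (w *m B).
  rewrite /quad -mulmxA SB mulmxA dotv_mulmx Ssym -mulmxA.
  have -> : S *m S = B + e%:M by rewrite subrK.
  rewrite mulmxDr dotvDr mul_mx_scalar dotvZr addrC.
  by [].
have kw : `|w *m S| <= k * `|w| by exact: mulmx_norm_le.
rewrite (quadD B (w *m S) y) qS.
have := le_trans _ (dotvv_ge (w *m B)).
move=> /(_ ((r * `|w|) ^+ 2)).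
rewrite lerXn2r ?nnegrE ?mulr_ge0 ?(ltW r0)// => /(_ isT) h1.
have := Bc (w *m S) y; have := Bc y (w *m S); have := Bc y y.
rewrite -/(quad B y) => /ler_normlP[h4 _] /ler_normlP[h3 _] /ler_normlP[h2 _].
have b1 : c * `|y| * `|w *m S| <= c * (ep * `|w|) * (k * `|w|).
  by apply: ler_pM; rewrite ?mulr_ge0// ler_wpM2l.
have b2 : c * `|y| * `|y| <= c * (ep * `|w|) * (1 * `|w|).
  apply: ler_pM; rewrite ?mulr_ge0// ?ler_wpM2l//; apply: le_trans yw _.
  by rewrite ler_wpM2r.
have b3 : C * ep * `|w| ^+ 2 <= r ^+ 2 * `|w| ^+ 2 by rewrite ler_wpM2r ?exprn_ge0.
rewrite /C in b3; rewrite exprMn in h1.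
have b4 : c * `|w *m S| * `|y| = c * `|y| * `|w *m S| by ring.
rewrite b4 in h2; lra.
Qed.

(** On two orbits that stay in the ball, quad B of the difference is bounded but
would grow like e ^ k if it were positive at the start. *)
Lemma staying_set_negligible n (T : 'rV[R]_n -> 'rV[R]_n) x (B : 'M[R]_n)
    (v : 'rV[R]_n) (e d : R) :
  1 < e -> 0 < quad B v -> 0 < d ->
  (forall a b, `|a - x| < d -> `|b - x| < d ->
     e * quad B (a - b) <= quad B (T a - T b)) ->
  negligible_dim n [set y | forall k, `|iter k T y - x| < d].
Proof.
move=> e1 qv d0 TB.
have M0 : 0 < `|x| + d by rewrite ltr_wpDl.
apply: (cone_free_negligible qv M0) => [y /(_ 0%N) /= yx|y z Wy Wz].
  rewrite -(subrK x y) addrC; apply: le_trans (ler_normD _ _) _.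
  by rewrite lerD2l ltW.
rewrite leNgt; apply/negP => q0; set q := quad B (y - z) in q0.
have [c c0 Bc] := bilinear_bound B.
have grow k : (1 + k%:R * (e - 1)) * q <= quad B (iter k T y - iter k T z).
  elim: k => [|k IH]; first by rewrite mul0r addr0 mul1r.
  apply: le_trans (TB _ _ (Wy k) (Wz k)).
  have e0 : 0 < e by lra.
  apply: le_trans (ler_wpM2l (ltW e0) IH); rewrite mulrA ler_wpM2r ?(ltW q0)//.
  rewrite -natr1; have : 0 <= k%:R * (e - 1) ^+ 2 by rewrite mulr_ge0// sqr_ge0.
  lra.
pose H : R := c * (2 * d) * (2 * d).
have bound k : (1 + k%:R * (e - 1)) * q <= H.
  apply: le_trans (grow k) _; apply: le_trans (ler_norm _) _.
  apply: le_trans (Bc _ _) _.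
  have yz : `|iter k T y - iter k T z| <= 2 * d.
    rewrite -(subrK x (iter k T y)) -addrA; apply: le_trans (ler_normD _ _) _.
    rewrite [X in _ + X]distrC; have := Wy k; have := Wz k; lra.
  by apply: ler_pM; rewrite ?mulr_ge0// ler_wpM2l.
have e10 : 0 < (e - 1) * q by rewrite mulr_gt0//; lra.
have := bound (Num.truncn (H / ((e - 1) * q))).+1.
have := truncnS_gt (H / ((e - 1) * q)); rewrite ltr_pdivrMr//.
set N : R := _.+1%:R; lra.
Qed.

(** A nonzero polynomial has too few roots to fill a + (b - a) / (k + 2). *)
Lemma non_root_between (p : {poly R}) (a b : R) : p != 0 -> a < b ->
  exists2 e, a < e < b & ~~ root p e.
Proof.
move=> p0 ab; apply: contrapT => nex.
pose g k : R := a + (b - a) / k.+2%:R.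
have ba : 0 < b - a by rewrite subr_gt0.
pose rs := [seq g k | k <- iota 0 (size p)].
have ars : all (root p) rs.
  apply/allP => _ /mapP[k _ ->]; apply: contrapT => /negP gk; apply: nex.
  exists (g k) => //; rewrite /g ltrDl divr_gt0//= addrC -ltrBrDr.
  by rewrite ltr_pdivrMr// ltr_pMr// ltr1n.
have urs : uniq rs.
  rewrite map_inj_uniq ?iota_uniq// => k l /addrI /(mulfI (lt0r_neq0 ba)) /invr_inj.
  by move/eqP; rewrite eqr_nat => /eqP[].
by have := max_poly_roots p0 ars urs; rewrite size_map size_iota ltnn.
Qed.

(** The threshold e must lie strictly between 1 and s ^ 2 and avoid the spectrum of
S *m S. The square treats eigenvalues of S of both signs alike. *)
Lemma unstable_staying_set_negligible n (T : 'rV[R]_n -> 'rV[R]_n) x (S : 'M[R]_n)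
    (s : R) : S^T = S -> strict_diff T x S -> eigenvalue S s -> 1 < s ->
  exists2 d : R, 0 < d &
    negligible_dim n [set y | forall k, `|iter k T y - x| < d].
Proof.
move=> Ssym TS /eigenvalueP[v vS v0] s1.
have s2 : 1 < s ^+ 2 by rewrite expr_gt1 ?ltW// (lt_trans ltr01 s1).
have [e /andP[e1 es] eN] := non_root_between (monic_neq0 (char_poly_monic (S *m S))) s2.
have Bu : S *m S - e%:M \in unitmx.
  apply: unitmx_ker => w; rewrite mulmxBr mul_mx_scalar => /subr0_eq wE.
  apply/eqP; apply: contraNT eN => w0.
  by rewrite -eigenvalue_root_char; apply/eigenvalueP; exists w.
have [d d0 Td] := cone_expanded Ssym TS Bu; exists d => //.
apply: (staying_set_negligible e1 (v := v) _ d0 Td).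
rewrite /quad mulmxBr mul_mx_scalar mulmxA vS -scalemxAl vS scalerA -scalerBl dotvZl.
rewrite mulr_gt0 ?subr_gt0 -?expr2//; apply: lt_le_trans (dotvv_ge v).
by rewrite exprn_gt0// normr_gt0.
Qed.

Lemma eigenvalue_le_lambda_max n (A : 'M[R]_n) a : eigenvalue A a -> a <= lambda_max A.
Proof.
move=> Aa; apply: ub_le_sup => //; exists (n%:R * `|A|) => b /eigenvalueP[v vA v0].
have vn : 0 < `|v| by rewrite normr_gt0.
rewrite -(ler_pM2r vn); apply: le_trans (mulmx_norm_le v A).
by rewrite vA normrZ ler_wpM2r// ler_norm.
Qed.

(** The infimum of the empty set is 0, so a negative lambda_min is witnessed by an
eigenvalue. *)
Lemma lambda_min_lt0 n (A : 'M[R]_n) : lambda_min A < 0 ->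
  exists2 a, eigenvalue A a & a < 0.
Proof.
move=> A0; apply: contrapT => nex; move: A0; rewrite ltNge => /negP; apply.
have [[a Aa]|NA] := pselect ([set a | eigenvalue A a] !=set0).
  apply: lb_le_inf => [|b Ab]; first by exists a.
  by rewrite leNgt; apply/negP => b0; apply: nex; exists b.
have E : [set a | eigenvalue A a] = set0.
  by apply/seteqP; split=> // a Aa; apply: NA; exists a.
by rewrite /lambda_min E inf0.
Qed.

End Cones.

(** * The iteration *)

Section Iteration.
Set Implicit Arguments.
Unset Strict Implicit.
Context {R : realType} {n : nat}.
Context (f : 'rV[R]_n -> R) (phi : 'rV[R]_n -> \bar R) (L Lbar gamma : R).
Hypothesis f_C2 : C2_on [set: 'rV[R]_n] f.
Hypothesis phi_ref : reference_function phi.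
Hypothesis phi_S : conditionS phi.
Hypothesis Lbar_gt0 : 0 < Lbar.
Local Notation T := (npgm_step f phi Lbar gamma).

Definition step_jacobian x : 'M[R]_n :=
  1%:M - gamma *: ((Lbar^-1 *: hessian f x) *m
                   hessian (rconjugate phi) (Lbar^-1 *: grad f x)).

Lemma grad_strict_diff x : strict_diff (grad f) x (hessian f x).
Proof.
have [_ dg cH] := f_C2; apply: C1_strict_diff; last exact: cH.
by apply/rv_nbhsP; exists 1 => // y _; exact: dg.
Qed.

Lemma npgm_step_strict_diff x : strict_diff T x (step_jacobian x).
Proof.
have [mu muP] := reference_modulus phi_ref.
apply: strict_diffB; first exact: strict_diff_id.
apply: strict_diffZ; apply: (strict_diff_comp (F := fun y => Lbar^-1 *: grad f y)).
  by apply: strict_diffZ; exact: grad_strict_diff.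
exact: grad_conjugate_strict_diff phi_ref _ muP phi_S _.
Qed.

Hypothesis f_smooth : anisotropic_smooth2 f phi L Lbar.
Hypothesis gamma_bounds : 0 < gamma < L^-1.
Hypothesis L_gt0 : 0 < L.

(** If u = (gamma / Lbar) u H P, then u H is an eigenvector of P H for
Lbar / gamma, which exceeds L Lbar. *)
Lemma step_jacobian_unitmx x : step_jacobian x \in unitmx.
Proof.
have /andP[g0 gL] := gamma_bounds.
rewrite /step_jacobian; set H := hessian f x; set P := hessian _ _.
apply: unitmx_ker => u; rewrite mulmxBr mulmx1 -scalemxAr -scalemxAl -scalemxAr.
rewrite scalerA mulmxA => /subr0_eq uE.
have [uH0|uH0] := eqVneq (u *m H) 0; first by rewrite uE uH0 mul0mx scaler0.
have eig : eigenvalue (P *m H) (Lbar / gamma).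
  apply/eigenvalueP; exists (u *m H); last exact: uH0.
  rewrite mulmxA [in RHS]uE -!scalemxAl scalerA.
  have -> : Lbar / gamma * (gamma * Lbar^-1) = 1 by field; rewrite !gt_eqF.
  by rewrite scale1r.
have := le_trans (eigenvalue_le_lambda_max eig) (f_smooth x).
rewrite leNgt => /negP[]; rewrite mulrC ltr_pM2l// -[L]invrK ltf_pV2//.
by rewrite posrE invr_gt0.
Qed.

Lemma npgm_step_expansive : locally_expansive T.
Proof.
move=> x; exact: strict_diff_expansive (step_jacobian_unitmx x) (npgm_step_strict_diff x).
Qed.

Hypothesis phi_normalized : hessian (rconjugate phi) 0 = 1%:M.

Lemma saddle_staying_set_negligible xs : strict_saddle f xs ->
  exists2 d : R, 0 < d &
    negligible_dim n [set y | forall k, `|iter k T y - xs| < d].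
Proof.
move=> [gf0 /lambda_min_lt0[a Ha a0]]; have /andP[g0 _] := gamma_bounds.
have JE : step_jacobian xs = 1%:M - (gamma / Lbar) *: hessian f xs.
  by rewrite /step_jacobian gf0 scaler0 phi_normalized mulmx1 scalerA.
apply: (unstable_staying_set_negligible (s := 1 - gamma / Lbar * a)
  _ (npgm_step_strict_diff xs)).
- rewrite JE linearB /= trmx1 linearZ /= (hessian_symmetric _ (grad_strict_diff xs))//.
  by move=> y; have [df _ _] := f_C2; exact: df.
- move: Ha => /eigenvalueP[v vH v0]; apply/eigenvalueP; exists v => //.
  by rewrite JE mulmxBr mulmx1 -scalemxAr vH scalerA scalerBl scale1r.
- by rewrite ltrDl oppr_gt0 pmulr_rlt0// divr_gt0.
Qed.

(** Strict saddles may be uncountable, so the balls provided for each of them are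
replaced by rational balls, of which only those with a negligible staying set
are kept. *)
Lemma saddle_basin_negligible :
  negligible_dim n [set x0 | exists2 xs, strict_saddle f xs &
    npgm f phi Lbar gamma x0 @ \oo --> xs].
Proof.
pose stay (i : 'rV[rat]_n * nat) :=
  [set y | forall k, rational_ball (R := R) i (iter k T y)].
pose W i := [set y | negligible_dim n (stay i) /\ stay i y].
have nW i : negligible_dim n (W i).
  have [ni|Nni] := pselect (negligible_dim n (stay i)).
    by apply: negligible_dim_sub ni => y [].
  by apply: negligible_dim_sub (negligible_dim0 _ n) => y [].
apply: (@negligible_dim_sub _ _ _ _
   (\bigcup_(j : nat * ('rV[rat]_n * nat)) [set x | W j.2 (iter j.1 T x)])).
  move=> x [xs sxs cvx].
  have [d d0 nd] := saddle_staying_set_negligible sxs.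
  have [i xi id_] := rational_ball_basis xs d0.
  have : nbhs xs (rational_ball i).
    apply/rv_nbhsP; exists (i.2.+1%:R^-1 - `|xs - map_mx ratr i.1|).
      by rewrite subr_gt0.
    move=> y yd; rewrite /rational_ball /= -(subrK xs y) -addrA.
    apply: le_lt_trans (ler_normD _ _) _; rewrite distrC -ltrBrDr; exact: yd.
  move=> /cvx[N _ NP]; exists (N, i) => //=; split.
    by apply: negligible_dim_sub nd => y yi k; apply: id_; exact: yi.
  by move=> k; rewrite -iterD; apply: NP; rewrite /= leq_addl.
apply: negligible_dim_bigcup_count => -[k i] /=.
apply: negligible_dim_preimage_iter => //; exact: npgm_step_expansive.
Qed.

End Iteration.

Theorem theorem3p1 (R : realType) (n : nat)
    (f : 'rV[R]_n -> R) (phi : 'rV[R]_n -> \bar R) (L Lbar gamma : R)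
    (f_C2 : C2_on [set: 'rV[R]_n] f)
    (phi_ref : reference_function phi)
    (phi_S : conditionS phi)
    (phi_normalized : hessian (rconjugate phi) 0 = 1%:M)
    (L_gt0 : 0 < L) (Lbar_gt0 : 0 < Lbar)
    (f_smooth : anisotropic_smooth2 f phi L Lbar)
    (gamma_bounds : 0 < gamma < L^-1) :
  lebesgue_null
    [set x0 : 'rV[R]_n | exists2 xs : 'rV[R]_n, strict_saddle f xs &
       npgm f phi Lbar gamma x0 @ \oo --> xs].
Proof.
have := saddle_basin_negligible f_C2 phi_ref phi_S Lbar_gt0 f_smooth gamma_bounds
  L_gt0 phi_normalized.
(* In dimension 0 there is no nonzero eigenvector, hence no strict saddle. *)
case: n f phi f_C2 phi_ref phi_S phi_normalized f_smooth
  => [|n] f phi f_C2 phi_ref phi_S phi_n f_smooth;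
  last exact: negligible_lebesgue_null.
move=> _; set A := [set x0 | _]; suff -> : A = set0 by exact: lebesgue_null0.
apply/seteqP; split=> // x [xs [_ /lambda_min_lt0[a /eigenvalueP[v _ /eqP v0] _]] _].
by case: v0; apply/rowP => -[].
Qed.
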